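(* Let $J$ be an object of $G$. Write $\widetilde\Upsilon=\widetilde\Upsilon_R$. (a) ${}_J\mathcal{X}$ consists of all points $v\in{}_J\mathcal{V}$ such that $B_J(v,\alpha)<0$ for only a finite number of $\alpha\in{}_J\widetilde\Upsilon^{\mathrm{re},+}$ and $B_J(v,\alpha)\geq 0$ for all $\alpha\in{}_J\widetilde\Upsilon^{\mathrm{im},+}$. (b) In (a), one can replace $\widetilde\Upsilon$ by $\widetilde\Upsilon_X$ for $X=P,M,R$. (c) For a morphism $(J,w,K)$ in $G$, one has $\mathcal{V}(w)({}_K\mathcal{X})={}_J\mathcal{X}$. (d) ${}_J\mathcal{C}\subseteq{}_J\mathcal{X}$ are convex cones in ${}_J\mathcal{V}\subseteq V$.
   Context: **Based root systems.** $\operatorname{span}(X)$ is the linear span, $\operatorname{cone}(X)$ the set of finite non-negative linear combinations of elements of $X$ (including $0$). $(V,B)$ is a real vector space with a symmetric bilinear form; $X^\perp=\{v\in V\mid B(v,x)=0\ \forall x\in X\}$; for $B(\alpha,\alpha)\neq 0$, $s_\alpha(v)=v-\frac{2B(v,\alpha)}{B(\alpha,\alpha)}\alpha$. $(\Phi,\Pi)$ is a based root system in $(V,B)$ with associated Coxeter system $(W,S)$: $\Pi\subseteq V$; $\operatorname{cone}(\Pi)\cap\operatorname{cone}(-\Pi)=\{0\}$; for all $\alpha\in\Pi$, $\alpha\notin\operatorname{cone}(\Pi\setminus\{\alpha\})$ and $B(\alpha,\alpha)=1$; $S=\{s_\alpha\mid\alpha\in\Pi\}$, $W=\langle S\rangle$;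 $\Phi=\{w\alpha\mid w\in W,\alpha\in\Pi\}$ satisfies $\Phi=\Phi^+\cup\Phi^-$ where $\Phi^{\pm}=\Phi\cap\operatorname{cone}(\pm\Pi)$. The rank may be infinite. $T=\{s_\alpha\mid\alpha\in\Phi\}$; $N(w)=\{t\in T\mid\ell(tw)<\ell(w)\}$. For $J\subseteq\Pi$, $W_J=\langle s_\alpha\mid\alpha\in J\rangle$; parabolic subgroups are conjugates of the $W_J$. Components of $J\subseteq \Pi$ are taken in the Coxeter graph on $\Pi$ (distinct $\alpha,\beta$ joined iff $s_\alpha s_\beta$ has order $\ge 3$ or $\infty$); a component is of finite type if it generates a finite group; $J_{\mathrm{fin}}$ is the union of the finite type components of $J$. **Reflection subgroups.** A reflection subgroup is a subgroup $U=\langle U\cap T\rangle$ of $W$; $\Pi_U=\{\alpha\in\Phi^+\mid N(s_\alpha)\cap U=\{s_\alpha\}\}$. $R_J$ is the set of reflection subgroups $U\supseteq W_J$ with $|\Pi_U\setminus J|=1$ (always $J\subseteq\Pi_U$); for $U\in R_J$, $r_{U,J}\in\Phi^+$ is defined by $\Pi_U=J\sqcup\{r_{U,J}\}$. $M_J$ is the set of inclusion-maximal elements of $R_J$, and $P_J$ the set of $U\in R_J$ that are parabolic in $W$. **Groupoid and standing assumption.** The full Brink-Howlett groupoid has as objects the subsets of $\Pi$; a morphism $J\to K$ is a triple $(K,w,J)$ with $w\in W$, $w(J)=K$; composition $(L,v,K)(K,w,J)=(L,vw,J)$. $G$ is a Brink-Howlett groupoid, i.e. a union of connected components of it. It is assumed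 that every object $J$ of $G$ satisfies: (i) for all $\alpha\in\Pi$, $B(\alpha,\beta)\neq0$ for only finitely many $\beta\in J_{\mathrm{fin}}$; (ii) $J=J_{\mathrm{fin}}$; (iii) $V=\operatorname{span}(J)\oplus J^\perp$. **Realized roots and cones.** For $J\in\mathrm{ob}(G)$: ${}_J\mathcal{V}=\mathcal{V}(J)=J^\perp$, $B_J$ is the restriction of $B$ to $J^\perp$, $\pi_J\colon V\to J^\perp$ is the orthogonal projection, and for a morphism $g=(K,w,J)$, $\mathcal{V}(g)=\mathcal{V}(w)\colon J^\perp\to K^\perp$ is the restriction of $w\colon V\to V$. Put ${}_J\Delta=\{\pi_J(\alpha)\mid\alpha\in\Pi\setminus J\}$. For $X\in\{R,M,P\}$, ${}_J\widetilde\Upsilon_X^{+}=\{\pi_J(r_{U,J})\mid U\in X_J\}$, ${}_J\widetilde\Upsilon_X^{-}=-{}_J\widetilde\Upsilon_X^{+}$, ${}_J\widetilde\Upsilon_X={}_J\widetilde\Upsilon_X^{+}\cup{}_J\widetilde\Upsilon_X^{-}$ (a disjoint union; these sets are permuted by the maps $\mathcal{V}(g)$). ${}_J\widetilde\Upsilon_X^{\mathrm{re},+}$ is the set of $\alpha\in{}_J\widetilde\Upsilon_X^{+}$ such that $\mathcal{V}(g)(\alpha)\in{}_K\widetilde\Upsilon_X^{-}$ for some object $K$ and some morphism $g\colon J\to K$ of $G$, and ${}_J\widetilde\Upsilon_X^{\mathrm{im},+}={}_J\widetilde\Upsilon_X^{+}\setminus{}_J\widetilde\Upsilon_X^{\mathrm{re},+}$.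 The fundamental chamber is ${}_J\mathcal{C}=\{v\in{}_J\mathcal{V}\mid B_J(v,\alpha)\ge0\ \forall\alpha\in{}_J\Delta\}$, and the Tits cone is ${}_J\mathcal{X}=\bigcup_{K\in\mathrm{ob}(G)}\bigcup_{(J,w,K)}\mathcal{V}(w)({}_K\mathcal{C})$, the inner union being over all morphisms $(J,w,K)\colon K\to J$ of $G$. *)

(* Defs.v *)
From Stdlib Require Export Relation_Operators.
From mathcomp Require Export all_boot all_order all_algebra.
From mathcomp Require Export sesquilinear.
From mathcomp Require Export boolp classical_sets functions cardinality reals.
From mathcomp Require Export convex.

Set Implicit Arguments.
Unset Strict Implicit.
Unset Printing Implicit Defensive.

Export Order.TTheory GRing.Theory Num.Theory.

Global Open Scope classical_set_scope.
Global Open Scope ring_scope.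

Definition span (R : realType) (V : lmodType R) (X : set V) : set V :=
  [set v | exists (n : nat) (x : 'I_n -> V) (c : 'I_n -> R),
    (forall i, X (x i)) /\ v = \sum_(i < n) c i *: x i].

Definition cone (R : realType) (V : lmodType R) (X : set V) : set V :=
  [set v | exists (n : nat) (x : 'I_n -> V) (c : 'I_n -> R),
    [/\ forall i, X (x i), forall i, 0 <= c i & v = \sum_(i < n) c i *: x i]].

Definition convex_cone (R : realType) (V : lmodType R) (A : set V) : Prop :=
  [/\ A 0, forall (c : R) v, 0 <= c -> A v -> A (c *: v) & convex_set A].

(* Subgroups are sets of maps closed under the group operations; they are only
   applied to sets of bijections, in which two-sided inverses exist. *)
Definition is_subgroup (T : Type) (M : set (T -> T)) : Prop :=
  [/\ M id,
      forall f g, M f -> M g -> M (f \o g)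
    & forall f g, M f -> cancel f g -> cancel g f -> M g].

Definition gen (T : Type) (X : set (T -> T)) : set (T -> T) :=
  smallest (@is_subgroup T) X.

Definition perp (R : realType) (V : lmodType R) (B : V -> V -> R) (X : set V)
  : set V :=
  [set v | forall x, X x -> B v x = 0].

Definition refl (R : realType) (V : lmodType R) (B : V -> V -> R) (a : V)
  : V -> V :=
  fun v => v - (2 * B v a / B a a) *: a.

(* [WJ B J] is the group W_J; the whole group W is [WJ B Pi]. *)
Definition WJ (R : realType) (V : lmodType R) (B : V -> V -> R) (J : set V)
  : set (V -> V) :=
  gen (refl B @` J).

Definition Phi (R : realType) (V : lmodType R) (B : V -> V -> R) (Pi : set V)
  : set V :=
  [set w a | w in WJ B Pi & a in Pi].

Definition Phi_pos (R : realType) (V : lmodType R) (B : V -> V -> R)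
  (Pi : set V) : set V :=
  Phi B Pi `&` cone Pi.

Definition Phi_neg (R : realType) (V : lmodType R) (B : V -> V -> R)
  (Pi : set V) : set V :=
  Phi B Pi `&` cone (-%R @` Pi).

Definition based_root_system (R : realType) (V : lmodType R)
  (B : V -> V -> R) (Pi : set V) : Prop :=
  [/\ cone Pi `&` cone (-%R @` Pi) = [set 0],
      forall a, Pi a -> ~ cone (Pi `\ a) a,
      forall a, Pi a -> B a a = 1
    & Phi B Pi = Phi_pos B Pi `|` Phi_neg B Pi].

Definition Trefl (R : realType) (V : lmodType R) (B : V -> V -> R)
  (Pi : set V) : set (V -> V) :=
  refl B @` Phi B Pi.

Definition is_word (R : realType) (V : lmodType R) (B : V -> V -> R)
  (Pi : set V) (n : nat) (w : V -> V) : Prop :=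
  exists s : seq V, [/\ size s = n, forall a, a \in s -> Pi a
    & w = foldr (fun a f => refl B a \o f) id s].

(* Length with respect to S; the value 0 outside W is never used. *)
Definition ell (R : realType) (V : lmodType R) (B : V -> V -> R)
  (Pi : set V) (w : V -> V) : nat :=
  xget 0%N [set n | is_word B Pi n w /\
                    forall m, is_word B Pi m w -> (n <= m)%N].

Definition Nset (R : realType) (V : lmodType R) (B : V -> V -> R)
  (Pi : set V) (w : V -> V) : set (V -> V) :=
  [set t | Trefl B Pi t /\ (ell B Pi (t \o w) < ell B Pi w)%N].

Definition cox_edge (R : realType) (V : lmodType R) (B : V -> V -> R)
  (a b : V) : Prop :=
  a <> b /\
  ~ (exists n : nat, (0 < n < 3)%N /\ iter n (refl B a \o refl B b) = id).

Definition component (R : realType) (V : lmodType R) (B : V -> V -> R)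
  (J : set V) (a : V) : set V :=
  [set b | J b /\
    clos_refl_trans V (fun x y => [/\ J x, J y & cox_edge B x y]) a b].

Definition components (R : realType) (V : lmodType R) (B : V -> V -> R)
  (J : set V) : set (set V) :=
  component B J @` J.

Definition finpart (R : realType) (V : lmodType R) (B : V -> V -> R)
  (J : set V) : set V :=
  \bigcup_(C in components B J `&` [set C | finite_set (WJ B C)]) C.

Definition reflection_subgroup (R : realType) (V : lmodType R)
  (B : V -> V -> R) (Pi : set V) (U : set (V -> V)) : Prop :=
  U = gen (U `&` Trefl B Pi).

Definition parabolic (R : realType) (V : lmodType R) (B : V -> V -> R)
  (Pi : set V) (U : set (V -> V)) : Prop :=
  exists (w w' : V -> V) (K : set V),
    [/\ WJ B Pi w, cancel w w' /\ cancel w' w, K `<=` Pi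
      & U = [set w \o u \o w' | u in WJ B K]].

Definition PiU (R : realType) (V : lmodType R) (B : V -> V -> R)
  (Pi : set V) (U : set (V -> V)) : set V :=
  [set a | Phi_pos B Pi a /\ Nset B Pi (refl B a) `&` U = [set refl B a]].

Inductive kind := kR | kM | kP.

Definition RJ (R : realType) (V : lmodType R) (B : V -> V -> R)
  (Pi J : set V) : set (set (V -> V)) :=
  [set U | [/\ reflection_subgroup B Pi U, WJ B J `<=` U
             & exists r, PiU B Pi U `\` J = [set r]]].

Definition MJ (R : realType) (V : lmodType R) (B : V -> V -> R)
  (Pi J : set V) : set (set (V -> V)) :=
  [set U | RJ B Pi J U /\ forall U', RJ B Pi J U' -> U `<=` U' -> U' = U].

Definition PJ (R : realType) (V : lmodType R) (B : V -> V -> R)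
  (Pi J : set V) : set (set (V -> V)) :=
  [set U | RJ B Pi J U /\ parabolic B Pi U].

Definition XJ (R : realType) (V : lmodType R) (B : V -> V -> R) (Pi : set V)
  (X : kind) (J : set V) : set (set (V -> V)) :=
  match X with kR => RJ B Pi J | kM => MJ B Pi J | kP => PJ B Pi J end.

Definition rUJ (R : realType) (V : lmodType R) (B : V -> V -> R)
  (Pi : set V) (U : set (V -> V)) (J : set V) : V :=
  xget 0 [set r | PiU B Pi U = J `|` [set r] /\ ~ J r].

(* [bh_hom B Pi K w J]: (K, w, J) is a morphism J -> K of the full groupoid. *)
Definition bh_hom (R : realType) (V : lmodType R) (B : V -> V -> R)
  (Pi K : set V) (w : V -> V) (J : set V) : Prop :=
  [/\ J `<=` Pi, K `<=` Pi, WJ B Pi w & w @` J = K].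

Definition bh_component (R : realType) (V : lmodType R) (B : V -> V -> R)
  (Pi J : set V) : set (set V) :=
  [set K | exists w, bh_hom B Pi K w J].

(* A union of connected components is a full subgroupoid, so it is determined
   by its set of objects. *)
Definition brink_howlett (R : realType) (V : lmodType R) (B : V -> V -> R)
  (Pi : set V) (ob : set (set V)) : Prop :=
  exists F : set (set V),
    F `<=` [set J | J `<=` Pi] /\ ob = \bigcup_(J in F) bh_component B Pi J.

Definition hom (R : realType) (V : lmodType R) (B : V -> V -> R)
  (Pi : set V) (ob : set (set V)) (K : set V) (w : V -> V) (J : set V)
  : Prop :=
  [/\ ob J, ob K & bh_hom B Pi K w J].

Definition standing (R : realType) (V : lmodType R) (B : V -> V -> R)
  (Pi J : set V) : Prop :=
  [/\ forall a, Pi a -> finite_set [set b | finpart B J b /\ B a b <> 0],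
      J = finpart B J,
      forall v, exists x y, [/\ span J x, perp B J y & v = x + y]
    & span J `&` perp B J = [set 0]].

(* Well defined when V is the direct sum of span J and its orthogonal. *)
Definition proj (R : realType) (V : lmodType R) (B : V -> V -> R) (J : set V)
  (v : V) : V :=
  xget 0 [set y | perp B J y /\ span J (v - y)].

(* The space attached to J is the subset [perp B J] of V, with the form B; the
   map attached to (K, w, J) is w itself, restricted to [perp B J]. *)

Definition Delta (R : realType) (V : lmodType R) (B : V -> V -> R)
  (Pi J : set V) : set V :=
  proj B J @` (Pi `\` J).

Definition Ups_pos (R : realType) (V : lmodType R) (B : V -> V -> R)
  (Pi : set V) (X : kind) (J : set V) : set V :=
  [set proj B J (rUJ B Pi U J) | U in XJ B Pi X J].

Definition Ups_neg (R : realType) (V : lmodType R) (B : V -> V -> R)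
  (Pi : set V) (X : kind) (J : set V) : set V :=
  -%R @` Ups_pos B Pi X J.

Definition Ups_re_pos (R : realType) (V : lmodType R) (B : V -> V -> R)
  (Pi : set V) (ob : set (set V)) (X : kind) (J : set V) : set V :=
  [set a | Ups_pos B Pi X J a /\
    exists K w, hom B Pi ob K w J /\ Ups_neg B Pi X K (w a)].

Definition Ups_im_pos (R : realType) (V : lmodType R) (B : V -> V -> R)
  (Pi : set V) (ob : set (set V)) (X : kind) (J : set V) : set V :=
  Ups_pos B Pi X J `\` Ups_re_pos B Pi ob X J.

Definition chamber (R : realType) (V : lmodType R) (B : V -> V -> R)
  (Pi J : set V) : set V :=
  [set v | perp B J v /\ forall a, Delta B Pi J a -> 0 <= B v a].

Definition tits (R : realType) (V : lmodType R) (B : V -> V -> R)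
  (Pi : set V) (ob : set (set V)) (J : set V) : set V :=
  \bigcup_(K in ob) \bigcup_(w in [set w | hom B Pi ob J w K])
    w @` chamber B Pi K.

(* Main.v *)
Require Import Defs.
From mathcomp Require Import interval_inference ring lra.

(** The Tits cone is a union of translates [w C_K] of fundamental chambers. If
    [v = w u] with [u] in [C_K] and [a = pi_J r] has [B v a < 0], then
    [B u (w^-1 r) < 0], so the root [w^-1 r] is negative. There are only
    finitely many positive [r] with this property, and for each of them the
    morphism [w^-1] carries [a] to a negative element, so [a] is real. Hence
    every point of the cone satisfies the stated inequalities ([tits_sub]).

    Conversely, let [v] satisfy them, and induct on the number of real positive
    [a] with [B v a < 0]. If [v] is not in the chamber of [J], some simple root
    [a] outside [J] has [B v a < 0]. As [pi_J a] belongs to each of the three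
    sets, it must be real: some morphism makes [a] negative. Factoring that
    morphism through the minimal element of its coset modulo the parabolic
    subgroup of [J + a] gives [b] in this subgroup with [b J] inside [J + a] and
    [b a < 0] ([simple_exchange]). The positive roots made negative by [b^-1]
    all lie in the parabolic subgroup, so [b] turns [pi_J a] into a negative
    element and creates no new negative value: [b v] has fewer negative values
    than [v] ([sub_tits]). The argument is the same for the three sets.

    Both directions rest on [RJ_transport]: a morphism [w : J -> K] carries
    [R_J] to [R_K], and [w (pi_J r)] is [pi_K r'] or [- pi_K r'] according to
    the sign of [w r]. Its ingredients are
    - the theory of canonical roots of a reflection subgroup: its positive roots
      lie in the cone of its canonical roots ([canonical_cone]), and a minimal
      coset representative carries canonical roots to canonical roots
      ([min_coset], [conj_PiU]);
    - linear algebra for [J] of finite type: [J] is linearly independent, and a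
      sum of two vectors of the cone of [Pi] lies in the span of [J] only if
      both lie in the cone of [J] ([simple_free], [cone_add_span]). This is
      derived from the sum of the positive roots of each finite component, a
      vector that pairs to 1 with the simple roots of the component;
    - the fact that a positive root of [U] outside the span of [J] has
      coefficient at least one on [r] ([coef_ge1]), which forces the
      proportionality factor between [w (pi_J r)] and [pi_K r'] to be a
      sign. *)

Set Implicit Arguments.
Unset Strict Implicit.
Unset Printing Implicit Defensive.

(** * Bilinear forms, spans and cones *)

Section Forms.
Variables (R : realType) (V : lmodType R) (B : {symmetric V}).
Implicit Types (x y z v a b : V) (c d : R) (X Y : set V).

Lemma BC x y : B x y = B y x.
Proof. by rewrite hermC expr0 mul1r. Qed.

Lemma BDl x y z : B (x + y) z = B x z + B y z.
Proof. exact: linearDl. Qed.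

Lemma BZl c x z : B (c *: x) z = c * B x z.
Proof. exact: linearZl. Qed.

Lemma BNl x z : B (- x) z = - B x z.
Proof. by rewrite -scaleN1r BZl mulN1r. Qed.

Lemma BBl x y z : B (x - y) z = B x z - B y z.
Proof. by rewrite BDl BNl. Qed.

Lemma B0l z : B 0 z = 0.
Proof. by rewrite -(scale0r 0) BZl mul0r. Qed.

Lemma BDr x y z : B z (x + y) = B z x + B z y.
Proof. by rewrite !(BC z) BDl. Qed.

Lemma BZr c x z : B z (c *: x) = c * B z x.
Proof. by rewrite !(BC z) BZl. Qed.

Lemma BNr x z : B z (- x) = - B z x.
Proof. by rewrite !(BC z) BNl. Qed.

Lemma BBr x y z : B z (x - y) = B z x - B z y.
Proof. by rewrite BDr BNr. Qed.

Lemma B0r z : B z 0 = 0.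
Proof. by rewrite BC B0l. Qed.

Lemma Bsuml (I : Type) (s : seq I) (F : I -> V) z :
  B (\sum_(i <- s) F i) z = \sum_(i <- s) B (F i) z.
Proof. by elim/big_rec2: _ => [|i y1 y2 _ <-]; rewrite (B0l, BDl). Qed.

Definition BE := (BDl, BDr, BBl, BBr, BZl, BZr, BNl, BNr, B0l, B0r).

Lemma span_ind (X P : set V) :
  P 0 -> (forall x y, P x -> P y -> P (x + y)) ->
  (forall c x, P x -> P (c *: x)) -> X `<=` P -> span X `<=` P.
Proof.
move=> P0 PD PZ XP _ [n [x [c [Xx ->]]]].
by elim/big_ind: _ => // i _; apply: PZ; apply: XP.
Qed.

Lemma cone_ind (X P : set V) :
  P 0 -> (forall x y, P x -> P y -> P (x + y)) ->
  (forall c x, 0 <= c -> P x -> P (c *: x)) -> X `<=` P -> cone X `<=` P.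
Proof.
move=> P0 PD PZ XP _ [n [x [c [Xx c0 ->]]]].
by elim/big_ind: _ => // i _; apply: PZ => //; apply: XP.
Qed.

Lemma span0 X : span X 0.
Proof. by exists 0, (fun=> 0), (fun=> 0); rewrite big_ord0; split=> // -[]. Qed.

Lemma cone0 X : cone X 0.
Proof.
by exists 0, (fun=> 0), (fun=> 0); rewrite big_ord0; split=> // -[].
Qed.

Lemma sub_span X : X `<=` span X.
Proof.
by move=> x Xx; exists 1%N, (fun=> x), (fun=> 1); rewrite big_ord1 scale1r.
Qed.

Lemma sub_cone X : X `<=` cone X.
Proof.
by move=> x Xx; exists 1%N, (fun=> x), (fun=> 1); rewrite big_ord1 scale1r.
Qed.

Lemma spanD X x y : span X x -> span X y -> span X (x + y).
Proof.
move=> [n [xs [c [Xx ->]]]] [m [ys [d [Xy ->]]]].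
exists (n + m)%N, (fun i : 'I_(n + m) => match fintype.split i with inl i =>
  xs i | inr i => ys i end),
  (fun i : 'I_(n + m) => match fintype.split i with inl i => c i | inr i =>
    d i end); split.
  by move=> i; case: fintype.split.
rewrite big_split_ord /=; congr (_ + _); apply: eq_bigr => i _.
  by rewrite (unsplitK (inl i)).
by rewrite (unsplitK (inr i)).
Qed.

Lemma coneD X x y : cone X x -> cone X y -> cone X (x + y).
Proof.
move=> [n [xs [c [Xx c0 ->]]]] [m [ys [d [Xy d0 ->]]]].
exists (n + m)%N, (fun i : 'I_(n + m) => match fintype.split i with inl i =>
  xs i | inr i => ys i end),
  (fun i : 'I_(n + m) => match fintype.split i with inl i => c i | inr i =>
    d i end); split.
- by move=> i; case: fintype.split.
- by move=> i; case: fintype.split.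
rewrite big_split_ord /=; congr (_ + _); apply: eq_bigr => i _.
  by rewrite (unsplitK (inl i)).
by rewrite (unsplitK (inr i)).
Qed.

Lemma spanZ X c x : span X x -> span X (c *: x).
Proof.
move=> [n [xs [d [Xx ->]]]]; exists n, xs, (fun i => c * d i); split=> //.
by rewrite scaler_sumr; apply: eq_bigr => i _; rewrite scalerA.
Qed.

Lemma coneZ X c x : 0 <= c -> cone X x -> cone X (c *: x).
Proof.
move=> c0 [n [xs [d [Xx d0 ->]]]]; exists n, xs, (fun i => c * d i); split=> //.
  by move=> i; apply: mulr_ge0.
by rewrite scaler_sumr; apply: eq_bigr => i _; rewrite scalerA.
Qed.

Lemma spanN X x : span X x -> span X (- x).
Proof. by move=> /(spanZ (-1)); rewrite scaleN1r. Qed.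

Lemma spanB X x y : span X x -> span X y -> span X (x - y).
Proof. by move=> Xx Xy; apply: spanD => //; apply: spanN. Qed.

Lemma span_sub X Y : X `<=` span Y -> span X `<=` span Y.
Proof.
by apply: span_ind; [exact: span0 | exact: spanD | exact: spanZ].
Qed.

Lemma cone_sub X Y : X `<=` cone Y -> cone X `<=` cone Y.
Proof.
by apply: cone_ind; [exact: cone0 | exact: coneD | exact: coneZ].
Qed.

Lemma spanS X Y : X `<=` Y -> span X `<=` span Y.
Proof. by move=> XY; apply: span_sub => x /XY/sub_span. Qed.

Lemma coneS X Y : X `<=` Y -> cone X `<=` cone Y.
Proof. by move=> XY; apply: cone_sub => x /XY/sub_cone. Qed.

Lemma cone_span X : cone X `<=` span X.
Proof.
apply: cone_ind; [exact: span0 | exact: spanD | | exact: sub_span].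
by move=> c x _; apply: spanZ.
Qed.

Lemma cone_opp X x : cone (-%R @` X) x <-> cone X (- x).
Proof.
have main (Y Z : set V) : -%R @` Y `<=` Z -> cone Y `<=` [set x | cone Z (- x)].
  move=> YZ; apply: cone_ind => /=.
  - by rewrite oppr0; apply: cone0.
  - by move=> y z Zy Zz; rewrite opprD; apply: coneD.
  - by move=> c y c0 Zy; rewrite -scalerN; apply: coneZ.
  - by move=> y Yy; apply: sub_cone; apply: YZ; exists y.
split; first by apply: main => _ [_ [y Xy <-] <-]; rewrite opprK.
by move=> /(@main X (-%R @` X)); rewrite /= opprK; apply.
Qed.

Lemma cone_split X Y x : cone X x ->
  exists y z, [/\ cone (X `&` Y) y, cone (X `\` Y) z & x = y + z].
Proof.
move: x; apply: cone_ind => /=.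
- by exists 0, 0; split; [exact: cone0 | exact: cone0 | rewrite addr0].
- move=> _ _ [y [z [Yy Yz ->]]] [y' [z' [Yy' Yz' ->]]].
  by exists (y + y'), (z + z'); split;
    [exact: coneD|exact: coneD|exact: addrACA].
- move=> c _ c0 [y [z [Yy Yz ->]]].
  by exists (c *: y), (c *: z); split;
    [exact: coneZ|exact: coneZ|exact: scalerDr].
- move=> x Xx; case: (pselect (Y x)) => Yx.
    by exists x, 0; split; [exact: sub_cone|exact: cone0|rewrite addr0].
  by exists 0, x; split; [exact: cone0|exact: sub_cone|rewrite add0r].
Qed.

Lemma cone1 a x : cone [set a] x -> exists2 c, 0 <= c & x = c *: a.
Proof.
move: x; apply: cone_ind => /=.
- by exists 0; rewrite ?scale0r.
- by move=> _ _ [c c0 ->] [d d0 ->]; exists (c + d);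
    rewrite ?addr_ge0 ?scalerDl.
- by move=> c _ c0 [d d0 ->]; exists (c * d); rewrite ?mulr_ge0 ?scalerA.
- by move=> _ ->; exists 1; rewrite ?scale1r.
Qed.

Lemma cone_add1 X a x : cone (X `|` [set a]) x ->
  exists c y, [/\ 0 <= c, cone X y & x = c *: a + y].
Proof.
move=> /(@cone_split _ [set a]) [y [z [ay az ->]]].
have /cone1[c c0 ->] : cone [set a] y by move: ay; apply: coneS => t [].
exists c, z; split=> //; move: az; apply: coneS => t [[//|->] []]; exact.
Qed.

Lemma cone_pos_le X z x : (forall a, X a -> B z a <= 0) -> cone X x ->
  B z x <= 0.
Proof.
move=> Xz; move: x; apply: cone_ind => //=.
- by rewrite B0r.
- by move=> x y Bx By; rewrite BDr; lra.
- by move=> c x c0 Bx; rewrite BZr mulr_ge0_le0.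
Qed.

Lemma cone_pos_ge X z x : (forall a, X a -> 0 <= B z a) -> cone X x ->
  0 <= B z x.
Proof.
move=> Xz; move: x; apply: cone_ind => //=.
- by rewrite B0r.
- by move=> x y Bx By; rewrite BDr; lra.
- by move=> c x c0 Bx; rewrite BZr mulr_ge0.
Qed.

Lemma perp_span X z x : perp B X z -> span X x -> B z x = 0.
Proof.
move=> Xz; move: x; apply: span_ind => //=.
- by rewrite B0r.
- by move=> x y Bx By; rewrite BDr Bx By addr0.
- by move=> c x Bx; rewrite BZr Bx mulr0.
Qed.

Lemma convex_coneP (A : set V) : A 0 -> (forall x y, A x -> A y -> A (x + y)) ->
  (forall c x, 0 <= c -> A x -> A (c *: x)) -> convex_cone A.
Proof.
move=> A0 AD AZ; split=> // x y t /set_mem Ax /set_mem Ay; apply/mem_set.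
by apply: AD; apply: AZ => //; rewrite subr_ge0.
Qed.

Lemma perp0 J : perp B J 0.
Proof. by move=> z _; rewrite B0l. Qed.

Lemma perpD J x y : perp B J x -> perp B J y -> perp B J (x + y).
Proof. by move=> Jx Jy z Jz; rewrite BDl Jx // Jy // addr0. Qed.

Lemma perpN J x : perp B J x -> perp B J (- x).
Proof. by move=> Jx z Jz; rewrite BNl Jx // oppr0. Qed.

Lemma perpB J x y : perp B J x -> perp B J y -> perp B J (x - y).
Proof. by move=> Jx Jy z Jz; rewrite BBl Jx // Jy // subr0. Qed.

Lemma perpZ J c x : perp B J x -> perp B J (c *: x).
Proof. by move=> Jx z Jz; rewrite BZl Jx // mulr0. Qed.

(** * Reflections *)
Lemma reflE a x : B a a = 1 -> refl B a x = x - (2 * B x a) *: a.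
Proof. by move=> a1; rewrite /refl a1 divr1. Qed.

Lemma reflD a x y : refl B a (x + y) = refl B a x + refl B a y.
Proof.
by rewrite /refl BDl mulrDr mulrDl scalerDl opprD addrACA.
Qed.

Lemma reflZ a c x : refl B a (c *: x) = c *: refl B a x.
Proof.
by rewrite /refl BZl scalerBr scalerA; congr (_ - _ *: _); ring.
Qed.

Lemma refl_self a : B a a = 1 -> refl B a a = - a.
Proof. by move=> a1; rewrite reflE // a1 mulr1 scaler_nat mulr2n opprD addrA
  subrr add0r. Qed.

Lemma reflK a : B a a = 1 -> involutive (refl B a).
Proof.
move=> a1 x; rewrite {2}/refl a1 reflD -scaleN1r !reflZ refl_self// reflE//.
by rewrite divr1 scalerN scaleN1r opprK subrK.
Qed.

Lemma reflB a x y : B a a = 1 -> B (refl B a x) (refl B a y) = B x y.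
Proof. by move=> a1; rewrite !reflE// !BE a1 (BC a y); ring. Qed.

End Forms.

(** * Based root systems *)

Section RootSystem.
Variables (R : realType) (V : lmodType R) (B : {symmetric V}) (Pi : set V).
Hypothesis hroot : based_root_system B Pi.
Implicit Types (x y z v a b : V) (c d : R) (X Y I J K : set V).
Implicit Types (w u f g : V -> V) (s : seq V) (U : set (V -> V)).

Local Notation W := (WJ B Pi).
Local Notation root := (Phi B Pi).
Local Notation pos := (Phi_pos B Pi).
Local Notation s_ := (refl B).
Local Notation l := (ell B Pi).

Lemma simple1 a : Pi a -> B a a = 1.
Proof. by case: hroot => _ _ + _; apply. Qed.

Lemma pointed x : cone Pi x -> cone Pi (- x) -> x = 0.
Proof.
move=> x1 x2; case: hroot => + _ _ _ => /seteqP[/(_ x) + _]; apply.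
by split=> //; apply/cone_opp.
Qed.

Lemma cone_sum0 x y : cone Pi x -> cone Pi y -> x + y = 0 -> x = 0.
Proof.
move=> x1 y1 /eqP; rewrite addr_eq0 => /eqP xy; apply: pointed => //.
by rewrite xy opprK.
Qed.

(** If [a] spans an extremal ray of a pointed cone, a decomposition of [a] inside
    the cone stays on that ray. *)
Lemma extremal X a x y : X `<=` cone Pi -> X a -> ~ cone (X `\ a) a ->
  cone X x -> cone X y -> a = x + y -> exists2 c, 0 <= c & x = c *: a.
Proof.
move=> XPi Xa na.
have cPi := cone_sub XPi.
have aux z : cone X z -> exists c t, [/\ 0 <= c,
  cone (X `\ a) t & z = c *: a + t].
  move=> /(@cone_split _ _ _ [set a])[t [t' [ht ht' ->]]].
  have /cone1[c c0 ->] : cone [set a] t by move: ht; apply: coneS => ? [].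
  by exists c, t'.
move=> /aux[c [t [c0 ht ->]]] /aux[d [t' [d0 ht' ->]]] E.
have XaX : cone (X `\ a) `<=` cone X by apply: coneS => ? [].
have {}E : (1 - (c + d)) *: a = t + t'.
  have E2 : a = (c + d) *: a + (t + t') by rewrite scalerDl addrACA.
  by rewrite scalerBl scale1r {1}E2 addrC addKr.
case: (ltP (c + d) 1) => cd.
  case: na; have : cone (X `\ a) ((1 - (c + d))^-1 *: (t + t')).
    by apply: coneZ; [rewrite invr_ge0; lra | exact: coneD].
  by rewrite -E scalerA mulVf ?scale1r // gt_eqF //; lra.
have t0 : t = 0.
  apply: (@cone_sum0 t (t' + (c + d - 1) *: a)); first exact/cPi/XaX.
    apply: coneD; first exact/cPi/XaX.
    by apply: coneZ; [lra | exact: XPi].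
  rewrite addrA -E -scalerDl; have -> : 1 - (c + d) + (c + d - 1) = 0 by ring.
  by rewrite scale0r.
by exists c => //; rewrite t0 addr0.
Qed.

Lemma simple_extremal a x y : Pi a ->
  cone Pi x -> cone Pi y -> a = x + y -> exists2 c, 0 <= c & x = c *: a.
Proof.
move=> Pa; apply: extremal => //; first exact: sub_cone.
by case: hroot => _ + _ _; apply.
Qed.

(** * The Coxeter group as a group of words *)

Lemma gen_subgroup (T : Type) (X : set (T -> T)) : is_subgroup (gen X).
Proof.
split=> [M [[]]//|f g Xf Xg M XM|f g Xf fg gf M XM].
  by case: (XM.1) => _ + _; apply; [exact: Xf|exact: Xg].
by case: (XM.1) => _ _ /(_ f g); apply => //; exact: Xf.
Qed.

Lemma sub_gen (T : Type) (X : set (T -> T)) : X `<=` gen X.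
Proof. by move=> f Xf M [_]; apply. Qed.

Lemma gen_min (T : Type) (X M : set (T -> T)) : is_subgroup M -> X `<=` M ->
  gen X `<=` M.
Proof. by move=> gM XM f; apply. Qed.

Lemma W_subgroup I : is_subgroup (WJ B I).
Proof. exact: gen_subgroup. Qed.

Lemma WJ_id I : WJ B I id.
Proof. by case: (gen_subgroup (s_ @` I)). Qed.

Lemma WJ_comp I f g : WJ B I f -> WJ B I g -> WJ B I (f \o g).
Proof. by case: (gen_subgroup (s_ @` I)) => _ + _; apply. Qed.

Lemma WJ_refl I a : I a -> WJ B I (s_ a).
Proof. by move=> Ia; apply: sub_gen; exists a. Qed.

Lemma WJS I K : I `<=` K -> WJ B I `<=` WJ B K.
Proof.
move=> IK; apply: gen_min; first exact: gen_subgroup.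
by move=> _ [a Ia <-]; apply: WJ_refl; apply: IK.
Qed.

(** The element of the group spelled by a word in simple roots. *)
Definition wd s : V -> V := foldr (fun a f => s_ a \o f) id s.

Lemma wd_cat s s' : wd (s ++ s') = wd s \o wd s'.
Proof. by elim: s => //= a s ->. Qed.

Lemma wd_rcons s a : wd (rcons s a) = wd s \o s_ a.
Proof. by rewrite -cats1 wd_cat. Qed.

Lemma wd_revK s : (forall a, a \in s -> Pi a) -> cancel (wd s) (wd (rev s)).
Proof.
elim: s => [|a s IH] sP x //=.
rewrite rev_cons wd_rcons /= reflK ?IH //; last first.
  by apply: simple1; apply: sP; rewrite mem_head.
by move=> b bs; apply: sP; rewrite inE bs orbT.
Qed.

Lemma wd_revK' s : (forall a, a \in s -> Pi a) -> cancel (wd (rev s)) (wd s).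
Proof.
by move=> sP; rewrite -{2}(revK s); apply: wd_revK => a; rewrite mem_rev;
  apply: sP.
Qed.

Lemma WJ_wd I s : (forall a, a \in s -> I a) -> WJ B I (wd s).
Proof.
elim: s => [|a s IH] sI /=; first exact: WJ_id.
apply: WJ_comp; first by apply: WJ_refl; apply: sI; rewrite mem_head.
by apply: IH => b bs; apply: sI; rewrite inE bs orbT.
Qed.

Lemma WJ_word I w : I `<=` Pi -> WJ B I w ->
  exists2 s, (forall a, a \in s -> I a) & w = wd s.
Proof.
move=> IPi; pose M := [set w | exists2 s, (forall a, a \in s ->
  I a) & w = wd s].
suff: WJ B I `<=` M by apply.
apply: gen_min => [|_ [a Ia <-]]; last first.
  by exists [:: a] => // b; rewrite inE => /eqP ->.
split=> [|_ _ [s sI ->] [s' sI' ->]|f g [s sI ->] fg gf].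
- by exists [::].
- exists (s ++ s'); last by rewrite wd_cat.
  by move=> a; rewrite mem_cat => /orP[]; [apply: sI|apply: sI'].
- exists (rev s); first by move=> a; rewrite mem_rev; apply: sI.
  apply/funext => x; rewrite -{2}(gf x) wd_revK // => a /sI; exact: IPi.
Qed.

Lemma W_word w : W w -> exists2 s, (forall a, a \in s -> Pi a) & w = wd s.
Proof. exact: WJ_word. Qed.

(** A total inverse operation on maps. It is meaningful for bijections only, in
    particular on the group generated by the reflections. *)
Definition inv w : V -> V := fun y => xget 0 [set x | w x = y].

Lemma inv_can w g : cancel w g -> cancel g w -> inv w = g.
Proof.
move=> wg gw; apply/funext => y; rewrite /inv;
  case: xgetP => [x _ /= <-|/(_ (g y))].
  by rewrite wg.
by rewrite /= gw.
Qed.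

Lemma W_K w : W w -> cancel w (inv w).
Proof.
by move=> /W_word[s sP ->]; rewrite (inv_can (wd_revK sP) (wd_revK' sP));
  apply: wd_revK.
Qed.

Lemma W_VK w : W w -> cancel (inv w) w.
Proof.
by move=> /W_word[s sP ->]; rewrite (inv_can (wd_revK sP) (wd_revK' sP));
  apply: wd_revK'.
Qed.

Lemma W_VKf w : W w -> w \o inv w = id.
Proof. by move=> Ww; apply/funext => x /=; rewrite W_VK. Qed.

Lemma sub_inv U w : is_subgroup U -> W w -> U w -> U (inv w).
Proof. by case=> _ _ + Ww Uw; apply; [exact: Uw|exact: W_K|exact: W_VK]. Qed.

Lemma W_inv w : W w -> W (inv w).
Proof. by move=> Ww; apply: (@sub_inv W) => //; apply: W_subgroup. Qed.

Lemma W_comp w u : W w -> W u -> W (w \o u).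
Proof. exact: WJ_comp. Qed.

Lemma inv_comp w u : W w -> W u -> inv (w \o u) = inv u \o inv w.
Proof.
by move=> Ww Wu; apply: inv_can => x /=; rewrite ?W_K ?W_VK.
Qed.

Lemma invK w : W w -> inv (inv w) = w.
Proof. by move=> Ww; apply: inv_can; [exact: W_VK|exact: W_K]. Qed.

Lemma inv_refl a : B a a = 1 -> inv (s_ a) = s_ a.
Proof. by move=> a1; apply: inv_can; apply: reflK. Qed.

Lemma W_D w x y : W w -> w (x + y) = w x + w y.
Proof. by move=> /W_word[s _ ->]; elim: s => //= a s ->; rewrite reflD. Qed.

Lemma W_Z w c x : W w -> w (c *: x) = c *: w x.
Proof. by move=> /W_word[s _ ->]; elim: s => //= a s ->; rewrite reflZ. Qed.

Lemma W_N w x : W w -> w (- x) = - w x.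
Proof. by move=> Ww; rewrite -scaleN1r W_Z // scaleN1r. Qed.

Lemma W_subr w x y : W w -> w (x - y) = w x - w y.
Proof. by move=> Ww; rewrite W_D // W_N. Qed.

Lemma W_0 w : W w -> w 0 = 0.
Proof. by move=> Ww; have := W_Z 0 0 Ww; rewrite !scale0r. Qed.

Lemma W_B w x y : W w -> B (w x) (w y) = B x y.
Proof.
move=> /W_word[s + ->]; elim: s => //= a s IH sP.
rewrite reflB; first by apply: IH => b bs; apply: sP; rewrite inE bs orbT.
by apply: simple1; apply: sP; rewrite mem_head.
Qed.

Lemma W_span w X x : W w -> span X x -> span (w @` X) (w x).
Proof.
move=> Ww; move: x; apply: span_ind => /=.
- by rewrite W_0 //; apply: span0.
- by move=> x y ? ?; rewrite W_D //; apply: spanD.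
- by move=> c x ?; rewrite W_Z //; apply: spanZ.
- by move=> x Xx; apply: sub_span; exists x.
Qed.

Lemma W_refl w a x : W w -> w (s_ a x) = s_ (w a) (w x).
Proof. by move=> Ww; rewrite /refl W_subr // W_Z // !W_B. Qed.

Lemma W_conj w a : W w -> w \o s_ a \o inv w = s_ (w a).
Proof. by move=> Ww; apply/funext => x /=; rewrite W_refl // W_VK. Qed.

(** * Positive and negative roots *)

Lemma root_simple a : Pi a -> root a.
Proof. by move=> Pa; exists id; [exact: WJ_id|exists a]. Qed.

Lemma root_W w a : W w -> root a -> root (w a).
Proof.
move=> Ww [u Wu [b Pb <-]]; exists (w \o u); last by exists b.
exact: WJ_comp.
Qed.

Lemma root1 a : root a -> B a a = 1.
Proof. by move=> [u Wu [b Pb <-]]; rewrite W_B // simple1. Qed.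

Lemma W_root a : root a -> W (s_ a).
Proof.
move=> [u Wu [b Pb <-]]; rewrite -W_conj //; apply: W_comp; last exact: W_inv.
by apply: W_comp => //; apply: WJ_refl.
Qed.

Lemma rootN a : root a -> root (- a).
Proof. by move=> ra; rewrite -(refl_self (root1 ra)); apply: root_W => //;
  apply: W_root. Qed.

Lemma root_refl a b : root a -> root b -> root (s_ a b).
Proof. by move=> ra; apply: root_W; apply: W_root. Qed.

Lemma root_pos a : root a -> pos a \/ pos (- a).
Proof.
move=> ra; have : (Phi_pos B Pi `|` Phi_neg B Pi) a by case: hroot => _ _ _ <-.
case=> [?|[_ /cone_opp]]; first by left.
by right; split=> //; apply: rootN.
Qed.

Lemma simple_pos a : Pi a -> pos a.
Proof. by move=> Pa; split; [exact: root_simple|exact: sub_cone]. Qed.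

Lemma root_neq0 a : root a -> a <> 0.
Proof. by move=> /root1 + a0; rewrite a0 B0l => /eqP;
  rewrite eq_sym oner_eq0. Qed.

Lemma posN a : pos a -> pos (- a) -> False.
Proof. by move=> [ra ca] [_ cNa]; apply: (root_neq0 ra); apply: pointed. Qed.

Lemma npos a : root a -> ~ pos a -> pos (- a).
Proof. by move=> /root_pos[]. Qed.

Lemma pos1 a : pos a -> B a a = 1.
Proof. by case=> /root1. Qed.

Lemma pos_root a : pos a -> root a.
Proof. by case. Qed.

Lemma reflN a : s_ (- a) = s_ a.
Proof.
apply/funext => x; rewrite /refl !BE opprK scalerN -scaleNr; congr (_ - _ *: _).
by rewrite mulrN mulNr opprK.
Qed.

Lemma root_colinear a b c : root a -> pos b -> cone Pi a -> a = c *: b -> a = b.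
Proof.
move=> ra [rb cb] ca E.
have := root1 ra; rewrite E !BE root1 // mulr1 => /eqP; rewrite -expr2 sqrf_eq1.
case/orP=> /eqP c1; move: E ca; rewrite c1 ?scale1r // scaleN1r => -> cNb.
by case: (root_neq0 rb); apply: pointed.
Qed.

Lemma refl_opp a b : root b -> s_ b a = - a -> a = B a b *: b.
Proof.
move=> /root1 b1; rewrite reflE // => /eqP.
rewrite subr_eq addrC -subr_eq opprK -mulr2n -scaler_nat -scalerA => /eqP.
by apply: scalerI; rewrite pnatr_eq0.
Qed.

Lemma refl_inj a b : pos a -> pos b -> s_ a = s_ b -> a = b.
Proof.
move=> pa pb E; apply: (@root_colinear a b (B a b)) => //; try by case: pa.
by apply: refl_opp; [case: pb|rewrite -E refl_self ?pos1].
Qed.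

(** A simple reflection permutes the positive roots other than its own root. *)
Lemma refl_pos a b : Pi a -> pos b -> b <> a -> pos (s_ a b).
Proof.
move=> Pa pb ba; have rab : root (s_ a b) by apply: root_refl => //;
  [exact: root_simple|case: pb].
case: (root_pos rab) => // -[_ cN]; case: ba.
have E : b + - s_ a b = (2 * B b a) *: a by rewrite reflE ?simple1 // opprB
  addrC subrK.
have [cb rb] : cone Pi b /\ root b by case: pb.
case: (lerP (2 * B b a) 0) => k0.
  case: (root_neq0 rb);
    apply: (@cone_sum0 b (- s_ a b + (- (2 * B b a)) *: a)) => //.
    by apply: coneD => //; apply: coneZ; [lra|exact: sub_cone].
  by rewrite addrA E -scalerDl subrr scale0r.
set k := 2 * B b a in E k0.
have ki : 0 <= k^-1 by rewrite invr_ge0 ltW.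
case: (@simple_extremal a (k^-1 *: b) (k^-1 *: - s_ a b)) => //.
- exact: coneZ.
- exact: coneZ.
- by rewrite -scalerDr E scalerA mulVf ?scale1r // gt_eqF //; lra.
move=> c c0 E'; apply: (@root_colinear b a (k * c)) => //;
  first exact: simple_pos.
by rewrite -scalerA -E' scalerA mulfV ?scale1r // gt_eqF //; lra.
Qed.

Lemma refl_neg a b : Pi a -> pos (- b) -> b <> - a -> pos (- s_ a b).
Proof.
move=> Pa pb ba; rewrite -W_N; last by apply: W_root; apply: root_simple.
by apply: refl_pos => // E; apply: ba; rewrite -E opprK.
Qed.

(** The strong exchange condition. *)
Lemma exchange s b : (forall a, a \in s -> Pi a) -> pos b ->
  pos (- wd (rev s) b) ->
  exists s1 a s2, [/\ s = s1 ++ a :: s2,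
    b = wd s1 a & s_ b \o wd s = wd (s1 ++ s2)].
Proof.
elim: s b => [|a s IH] b sP pb; first by move=> /(posN pb).
have Pa : Pi a by apply: sP; rewrite mem_head.
rewrite rev_cons wd_rcons /= => pN.
case: (pselect (b = a)) => [->|ba].
  exists [::], a, s; split=> //=; apply/funext => x /=; rewrite reflK //;
    exact: simple1.
have [||//|s1 [c [s2 [-> E1 E2]]]] := IH (s_ a b).
- by move=> c cs; apply: sP; rewrite inE cs orbT.
- exact: refl_pos.
exists (a :: s1), c, s2; split=> //=.
  by rewrite -E1 reflK // simple1.
rewrite -E2; apply/funext => x /=.
by rewrite (W_refl _ _ (W_root (root_simple Pa))) reflK // simple1.
Qed.

(** * Length *)

Lemma ell_spec w : W w -> is_word B Pi (l w) w /\ forall m,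
  is_word B Pi m w -> (l w <= m)%N.
Proof.
move=> /W_word[s sP E]; rewrite /ell; case: xgetP => [n _ //|/=].
pose p n := `[< is_word B Pi n w >].
have ex : exists n, p n by exists (size s); apply/asboolP; exists s.
case: (ex_minnP ex) => n /asboolP pn nm /(_ n); case; split=> // m pm.
by apply: nm; apply/asboolP.
Qed.

Lemma ell_wd s : (forall a, a \in s -> Pi a) -> (l (wd s) <= size s)%N.
Proof. by move=> sP; case: (ell_spec (WJ_wd sP)) => _; apply; exists s. Qed.

Lemma ell_word w : W w -> exists s, [/\ (forall a, a \in s ->
  Pi a), w = wd s & size s = l w].
Proof. by move=> /ell_spec[[s [? ? ?]] _]; exists s. Qed.

Lemma ell_inv w : W w -> l (inv w) = l w.
Proof.
have main u : W u -> (l (inv u) <= l u)%N.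
  move=> /[dup] Wu /ell_word[s [sP -> <-]].
  rewrite (inv_can (wd_revK sP) (wd_revK' sP)) -size_rev; apply: ell_wd => a.
  by rewrite mem_rev; apply: sP.
by move=> Ww; apply/eqP; rewrite eqn_leq main //= -{1}(invK Ww) main //;
  apply: W_inv.
Qed.

Lemma ell_neg w b : W w -> pos b -> pos (- inv w b) -> (l (s_ b \o w) < l w)%N.
Proof.
move=> /ell_word[s [sP -> <-]] pb; rewrite (inv_can (wd_revK sP) (wd_revK' sP)).
move=> /(exchange sP pb)[s1 [a [s2 [Es _ ->]]]].
rewrite Es size_cat /= addnS ltnS -size_cat; apply: ell_wd => c cs.
by apply: sP; rewrite Es mem_cat inE orbCA -mem_cat cs orbT.
Qed.

(** The inversion set of the group element [w], in terms of roots. *)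
Lemma ell_ltE w b : W w -> pos b -> (l (s_ b \o w) < l w)%N <-> pos (- inv w b).
Proof.
move=> Ww pb; split; last exact: ell_neg.
move=> lt; apply: npos; first by apply: root_W; [exact: W_inv|case: pb].
move=> pi; have Wb : W (s_ b) by apply: W_root; case: pb.
have : (l (s_ b \o (s_ b \o w)) < l (s_ b \o w))%N.
  apply: ell_neg => //; first exact: W_comp.
  rewrite inv_comp //= inv_refl ?pos1 // refl_self ?pos1 //.
  by rewrite W_N ?opprK //; apply: W_inv.
have -> : s_ b \o (s_ b \o w) = w by apply/funext => x /=; rewrite reflK ?pos1.
by move=> /(ltn_trans lt); rewrite ltnn.
Qed.

(** The length of the reflection in a positive root drops when the root is
    reflected in a simple root with which it pairs positively. Several later
    proofs are inductions on this length. *)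
Lemma ell_refl_lt a b : Pi a -> pos b -> b <> a -> 0 < B b a ->
  (l (s_ (s_ a b)) < l (s_ b))%N.
Proof.
move=> Pa pb ba Bba.
have ra := root_simple Pa; have rb := pos_root pb.
have Wa := W_root ra; have Wb := W_root rb.
have n1 : pos (- s_ b a).
  apply: npos; first exact: root_refl.
  move=> [_ cba]; apply: ba.
  have [|||c c0] := @simple_extremal a ((2 * B a b) *: b) (s_ b a) Pa => //.
  - by apply: coneZ; [rewrite BC; lra|case: pb].
  - by rewrite reflE ?pos1 // addrC subrK.
  move=> E; apply: (@root_colinear b a ((2 * B a b)^-1 * c)) => //;
    [exact: simple_pos|by case: pb|].
  by rewrite -scalerA -E scalerA mulVf ?scale1r // BC gt_eqF //; lra.
have n2 : pos (- s_ a (s_ b a)).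
  apply: refl_neg => // E; apply: ba.
  by rewrite (@root_colinear a b (B a b)) //;
    [case: (simple_pos Pa)|exact: refl_opp].
have <- : s_ a \o (s_ b \o s_ a) = s_ (s_ a b).
  by rewrite -(W_conj _ Wa) inv_refl ?simple1.
apply: (@ltn_trans (l (s_ b \o s_ a))).
  apply: ell_neg; [exact: W_comp|exact: simple_pos|].
  by rewrite (inv_comp Wb Wa) /= (inv_refl (simple1 Pa)) (inv_refl (pos1 pb)).
have -> : s_ b \o s_ a = inv (s_ a \o s_ b).
  by rewrite (inv_comp Wa Wb) (inv_refl (simple1 Pa)) (inv_refl (pos1 pb)).
rewrite ell_inv; last exact: W_comp.
by apply: ell_neg => //; [exact: simple_pos|rewrite (inv_refl (pos1 pb))].
Qed.

(** * Reflection subgroups and their canonical roots *)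

(** The positive roots whose reflection belongs to [U]. *)
Definition RU U : set V := [set b | pos b /\ U (s_ b)].

(** The conjugate of [U] by [w]. *)
Definition conjU w U : set (V -> V) := [set w \o u \o inv w | u in U].

Lemma RU_or U b : root b -> U (s_ b) -> RU U b \/ RU U (- b).
Proof.
move=> rb Ub; case: (root_pos rb) => pb; [left|right]; split=> //.
by rewrite reflN.
Qed.

Lemma RU_cone U : RU U `<=` cone Pi.
Proof. by move=> b [[]]. Qed.

(** A positive root of [U] is canonical iff its reflection permutes the other
    positive roots of [U]. *)
Lemma PiUP U a : PiU B Pi U a <->
  RU U a /\ forall b, RU U b -> b <> a -> pos (s_ a b).
Proof.
split=> [[pa E]|[[pa Ua] H]].
  have [_ Ua] : (Nset B Pi (s_ a) `&` U) (s_ a) by rewrite E.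
  split=> // b [pb Ub] ba.
  have rab := root_refl (pos_root pa) (pos_root pb).
  case: (pselect (pos (s_ a b))) => // /(npos rab) n; case: ba.
  apply: refl_inj => //; have : [set s_ a] (s_ b); last by [].
  rewrite -E; split=> //; split; first by exists b => //; case: pb.
  apply: ell_neg => //; first by apply: W_root; case: pa.
  by rewrite inv_refl ?pos1.
have Wa := W_root (pos_root pa).
split=> //; apply/seteqP; split=> [t [[[b rb <-] lt] Ub]|_ ->].
  wlog pb : b rb lt Ub / pos b.
    move=> IH; case: (root_pos rb) => pb; first exact: IH.
    by rewrite -(reflN b); apply: IH; rewrite ?reflN //; apply: rootN.
  apply: contrapT => ba; have {}ba : b <> a by move=> E; apply: ba; rewrite E.
  move/(ell_ltE Wa pb): lt; rewrite (inv_refl (pos1 pa)).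
  by apply: posN; apply: H.
split=> //; split; first by exists a => //; case: pa.
apply: ell_neg => //; rewrite (inv_refl (pos1 pa)) (refl_self (pos1 pa)).
by rewrite opprK.
Qed.

Lemma PiU_RU U : PiU B Pi U `<=` RU U.
Proof. by move=> a /PiUP[]. Qed.

Lemma PiU_simple U a : Pi a -> U (s_ a) -> PiU B Pi U a.
Proof.
move=> Pa Ua; apply/PiUP; split; first by split=> //; apply: simple_pos.
by move=> b [pb _] ba; apply: refl_pos.
Qed.

Lemma conj_sub w U U' : U `<=` U' -> conjU w U `<=` conjU w U'.
Proof. by move=> UU _ [u Uu <-]; exists u => //; apply: UU. Qed.

Lemma conj_W w U : W w -> U `<=` W -> conjU w U `<=` W.
Proof.
move=> Ww UW _ [u /UW Wu <-]; apply: W_comp; last exact: W_inv.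
exact: W_comp.
Qed.

Lemma conjK w U : W w -> conjU (inv w) (conjU w U) = U.
Proof.
move=> Ww; apply/seteqP; split=> [_ [_ [u Uu <-] <-]|u Uu].
  rewrite invK //; suff -> : inv w \o (w \o u \o inv w) \o w = u by [].
  by apply/funext => x /=; rewrite !W_K.
exists (w \o u \o inv w); first by exists u.
by rewrite invK //; apply/funext => x /=; rewrite !W_K.
Qed.

Lemma conjVK w U : W w -> conjU w (conjU (inv w) U) = U.
Proof. by move=> Ww; rewrite -{1}(invK Ww) conjK //; apply: W_inv. Qed.

Lemma conj_subgroup w U : W w -> is_subgroup U -> is_subgroup (conjU w U).
Proof.
move=> Ww [U1 U2 U3]; split.
- by exists id => //; rewrite W_VKf.
- move=> _ _ [u Uu <-] [v Uv <-]; exists (u \o v); first exact: U2.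
  by apply/funext => x /=; rewrite W_K.
- move=> _ g [u Uu <-] ug gu; exists (inv w \o g \o w).
    apply: (U3 u) => // x /=.
      by have := ug (w x); rewrite /= W_K // => ->; rewrite W_K.
    by have := gu (w x) => /= /(congr1 (inv w)); rewrite !W_K.
  by apply/funext => x /=; rewrite !W_VK.
Qed.

Lemma conj_refl w U b : W w -> conjU w U (s_ (w b)) <-> U (s_ b).
Proof.
move=> Ww; split=> [|Ub]; last by exists (s_ b) => //; rewrite W_conj.
rewrite -W_conj // => -[u Uu E]; suff <- : u = s_ b by [].
apply/funext => x; move/(congr1 (fun f => inv w (f (w x)))): E => /=.
by rewrite !W_K.
Qed.

Lemma subgroup_refl U a b : is_subgroup U -> root a -> U (s_ a) -> U (s_ b) ->
  U (s_ (s_ a b)).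
Proof.
move=> [_ U2 _] ra Ua Ub; rewrite -(W_conj _ (W_root ra)) (inv_refl (root1 ra)).
by apply: (U2) => //; apply: (U2).
Qed.

(** Induction on the length of the reflection: a simple root [a] pairing
    positively with [b] is either canonical for [U], and can be split off, or its
    reflection is not in [U], and conjugating by it carries the canonical roots of
    the conjugate of [U] back to those of [U]. *)
Lemma canonical_cone U b : is_subgroup U -> U `<=` W -> RU U b ->
  cone (PiU B Pi U) b.
Proof.
have [n] := ubnP (l (s_ b)); elim: n U b => // n IH U b ltn sU UW [pb Ub].
case: (pselect (Pi b)) => Pb; first by apply: sub_cone; apply: PiU_simple.
have [a Pa Bba] : exists2 a, Pi a & 0 < B b a.
  apply: contrapT => H; have : B b b <= 0.
    apply: (@cone_pos_le _ _ _ Pi); last by case: pb.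
    by move=> a Pa; rewrite leNgt; apply/negP => ?; apply: H; exists a.
  by rewrite pos1 // ler10.
have ba : b <> a by move=> ba; apply: Pb; rewrite ba.
have pab := refl_pos Pa pb ba.
have lt2 := ell_refl_lt Pa pb ba Bba.
have {ltn lt2}lt3 : (l (s_ (s_ a b)) < n)%N by apply: (leq_trans lt2);
  rewrite -ltnS.
have Wa := W_root (root_simple Pa); have a1 := simple1 Pa.
have Va := inv_refl a1; have Ka := reflK a1.
case: (pselect (U (s_ a))) => Ua.
  have -> : b = s_ a b + (2 * B b a) *: a by rewrite reflE // subrK.
  apply: coneD.
    apply: IH => //; split=> //; apply: subgroup_refl => //; exact: root_simple.
  by apply: coneZ; [lra|apply: sub_cone; apply: PiU_simple].
pose U' := conjU (s_ a) U.
have cU' : cone (PiU B Pi U') (s_ a b).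
  apply: IH => //; [exact: conj_subgroup|exact: conj_W|].
  by split=> //; apply/conj_refl.
have U'a : ~ U' (s_ a).
  by rewrite -reflN -(refl_self a1) => /(conj_refl _ _ Wa).
have RU' (c : V) : RU U c -> RU U' (s_ a c).
  move=> [pc Uc]; split; last by apply/conj_refl.
  by apply: refl_pos => // E; apply: Ua; rewrite -E.
have main (c : V) : PiU B Pi U' c -> PiU B Pi U (s_ a c).
  move=> /PiUP[[pc U'c] H].
  have Uc : U (s_ (s_ a c)) by apply/(conj_refl _ _ Wa); rewrite Ka.
  have ca : c <> a by move=> E; apply: U'a; rewrite -E.
  apply/PiUP; split; first by split=> //; apply: refl_pos.
  move=> d Rd dc; rewrite -(Ka d) -W_refl //.
  have pcd : pos (s_ c (s_ a d)).
    by apply: H; [exact: RU'|move=> E; apply: dc; rewrite -E Ka].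
  apply: refl_pos => // E; apply: U'a; rewrite -E.
  have [_ U'd] := RU' _ Rd.
  by apply: subgroup_refl => //; [exact: conj_subgroup|case: pc].
have {cU'} : cone [set c : V | PiU B Pi U (s_ a c)]
  (s_ a b) by apply: coneS cU'.
suff gen x : cone [set c : V | PiU B Pi U (s_ a c)] x ->
  cone (PiU B Pi U) (s_ a x).
  by move/gen; rewrite Ka.
move: x; apply: cone_ind => /=.
- by rewrite W_0 //; apply: cone0.
- by move=> x y ? ?; rewrite W_D //; apply: coneD.
- by move=> c x ? ?; rewrite W_Z //; apply: coneZ.
- by move=> x ?; apply: sub_cone.
Qed.

Lemma canonical_extremal U a : PiU B Pi U a -> ~ cone (RU U `\ a) a.
Proof.
move=> /[dup] /PiU_RU[pa Ua] /PiUP[_ H].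
have Wa := W_root (pos_root pa).
have gen x : cone (RU U `\ a) x -> cone Pi (s_ a x).
  move: x; apply: cone_ind => /=.
  - by rewrite W_0 //; apply: cone0.
  - by move=> x y ? ?; rewrite W_D //; apply: coneD.
  - by move=> c x ? ?; rewrite W_Z //; apply: coneZ.
  - by move=> x [Rx xa]; case: (H x Rx xa).
move=> /gen; rewrite refl_self ?pos1 // => cNa.
by apply: (root_neq0 (pos_root pa)); apply: pointed => //; case: pa.
Qed.

(** Distinct canonical roots form a non-acute angle: otherwise [b] would be a
    positive combination of two other positive roots of [U]. *)
Lemma canonical_le0 U a b : is_subgroup U ->
  PiU B Pi U a -> PiU B Pi U b -> a <> b -> B a b <= 0.
Proof.
move=> sU Ua Ub ab; rewrite leNgt; apply/negP => Bab.
have [[pa Uaa] Ha] := (PiUP U a).1 Ua; have [[pb Ubb] _] := (PiUP U b).1 Ub.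
have pab : pos (s_ a b) by apply: Ha => // E; apply: ab.
have Wa := W_root (pos_root pa).
have Rab : RU U (s_ a b).
  by split=> //; apply: subgroup_refl => //; case: pa.
have [|||||c c0 E] := @extremal (RU U) b ((2 * B b a) *: a) (s_ a b) (@RU_cone
  U).
- by split.
- exact: canonical_extremal.
- by apply: coneZ; [rewrite BC; lra|apply: sub_cone].
- exact: sub_cone.
- by rewrite reflE ?pos1 // addrC subrK.
apply: ab; apply: (@root_colinear a b ((2 * B b a)^-1 * c)) => //;
  [by case: pa|by case: pa|].
by rewrite -scalerA -E scalerA mulVf ?scale1r // BC gt_eqF //; lra.
Qed.

(** * Standard parabolic subgroups and minimal coset representatives *)

(** A nontrivial element of a standard parabolic subgroup makes one of the simple
    roots of this subgroup negative. *)
Lemma descent I w : I `<=` Pi -> WJ B I w -> (forall a, I a -> pos (w a)) ->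
  w = id.
Proof.
move=> IPi Iw H; have [s sI E] := WJ_word IPi Iw.
have [n] := ubnP (size s); elim: n s sI E => // n IH s.
case: (lastP s) => [//|s' a] sI E; rewrite size_rcons ltnS => ltn.
have Ia : I a by apply: sI; rewrite mem_rcons mem_head.
have Pa := IPi _ Ia.
have s'I b : b \in s' -> I b by move=> bs; apply: sI;
  rewrite mem_rcons inE bs orbT.
have s'P b : b \in s' -> Pi b by move=> /s'I/IPi.
have pN := H a Ia; rewrite E wd_rcons /= (refl_self (simple1 Pa)) in pN.
have Ws' : W (wd s') by apply: WJ_wd.
rewrite W_N // in pN.
have [||s1 [b [s2 [E1 _ E2]]]] := @exchange (rev s') a _ (simple_pos Pa).
- by move=> b; rewrite mem_rev; apply: s'P.
- by rewrite revK.
have sub b' : b' \in s1 ++ s2 -> b' \in s'.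
  by rewrite -(mem_rev s') E1 !mem_cat inE; case/orP => ->; rewrite ?orbT.
apply: (IH (rev (s1 ++ s2))).
- by move=> b'; rewrite mem_rev => /sub/s'I.
- have s12P b' : b' \in s1 ++ s2 -> Pi b' by move=> /sub/s'P.
  rewrite E -(inv_can (wd_revK s12P) (wd_revK' s12P)) -E2.
  have s'P' b' : b' \in rev s' -> Pi b' by rewrite mem_rev; apply: s'P.
  have Wr := WJ_wd s'P'; have Wa := W_root (root_simple Pa).
  rewrite (inv_comp Wa Wr) (inv_refl (simple1 Pa)).
  by rewrite (inv_can (wd_revK s'P') (wd_revK' s'P')) revK wd_rcons.
- rewrite size_rev size_cat; apply: leq_trans ltn.
  by rewrite -(size_rev s') E1 size_cat /= addnS.
Qed.

Lemma PiU_WJ I : I `<=` Pi -> PiU B Pi (WJ B I) = I.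
Proof.
move=> IPi; apply/seteqP; split=> [a|a Ia]; last first.
  by apply: PiU_simple; [exact: IPi|exact: WJ_refl].
move=> /PiUP[[pa Ia] H]; apply: contrapT => nIa.
have : s_ a a = a.
  rewrite {1}(@descent I (s_ a)) // => b Ib; apply: H.
    by split; [exact/simple_pos/IPi|exact: WJ_refl].
  by move=> E; apply: nIa; rewrite -E.
rewrite refl_self ?pos1 // => E; apply: (posN pa); rewrite E //.
Qed.

Lemma RU_WJ_cone I : I `<=` Pi -> RU (WJ B I) `<=` cone I.
Proof.
move=> IPi b; rewrite -{2}(PiU_WJ IPi); apply: canonical_cone.
  exact: W_subgroup.
exact: WJS.
Qed.

(** An element [w u] of minimal length in the coset [w U] keeps the positive roots
    of [U] positive. *)
Lemma min_coset U w : is_subgroup U -> U `<=` W -> W w ->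
  exists2 u, U u & forall b, RU U b -> pos (w (u b)).
Proof.
move=> [U1 U2 _] UW Ww.
pose p n := `[< exists2 u, U u & l (w \o u) = n >].
have ex : exists n, p n by exists (l w); apply/asboolP; exists id.
case: (ex_minnP ex) => n /asboolP[u Uu En] nm; exists u => // b [pb Ub].
have Wu := UW _ Uu; have Wwu := W_comp Ww Wu; have Wb := W_root (pos_root pb).
apply: contrapT => /(npos (root_W Wwu (pos_root pb))) /= pN.
have lt : (l (s_ b \o inv (w \o u)) < l (inv (w \o u)))%N.
  by apply: ell_neg => //; [exact: W_inv|rewrite invK].
rewrite ell_inv // En ltnNge in lt; case/negP: lt; apply: nm; apply/asboolP.
exists (u \o s_ b); first exact: U2.
rewrite -ell_inv; first by rewrite (inv_comp Wwu Wb) (inv_refl (pos1 pb)).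
exact: (W_comp Wwu).
Qed.

Lemma conj_RU U w : W w -> is_subgroup U -> (forall b, RU U b -> pos (w b)) ->
  RU (conjU w U) = w @` RU U.
Proof.
move=> Ww sU H; apply/seteqP; split=> [c [pc Uc]|_ [b [pb Ub] <-]]; last first.
  by split; [exact: H|exact/conj_refl].
have Ec : c = w (inv w c) by rewrite W_VK.
have Ub : U (s_ (inv w c)) by apply/(conj_refl _ _ Ww); rewrite -Ec.
exists (inv w c) => //; case: (RU_or _ Ub) => //.
  by apply: root_W; [exact: W_inv|case: pc].
by move=> /H; rewrite W_N // -Ec => /(posN pc).
Qed.

Lemma conj_PiU U w : W w -> is_subgroup U -> (forall b, RU U b -> pos (w b)) ->
  PiU B Pi (conjU w U) = w @` PiU B Pi U.
Proof.
move=> Ww sU H; have E := conj_RU Ww sU H.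
apply/seteqP; split=> [c /PiUP[]|_ [a /PiUP[Ra Ha] <-]].
  rewrite E => -[a Ra <-] Ha; exists a => //; apply/PiUP; split=> // b Rb ba.
  have pab : pos (s_ (w a) (w b)).
    by apply: Ha; [exists b|move=> /(can_inj (W_K Ww))].
  have rr : root (s_ a b) by case: Ra Rb => [[ra _] _] [[rb _] _];
    apply: root_refl.
  case: (root_pos rr) => // n; case: (posN pab).
  rewrite -W_refl // -W_N //; apply: H; split=> //.
  by have [[[ra _] Ua] [_ Ub]] := (Ra, Rb); rewrite reflN; apply: subgroup_refl.
apply/PiUP; rewrite E; split; first by exists a.
move=> _ [b Rb <-] ba; rewrite -W_refl //; apply: H; split.
  by apply: Ha => // Eb; apply: ba; rewrite Eb.
by have [[[ra _] Ua] [_ Ub]] := (Ra, Rb); apply: subgroup_refl.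
Qed.

(** * Sets of simple roots of finite type *)

(** Simple roots not joined in the Coxeter graph are orthogonal. *)
Lemma no_edge_orth a b : Pi a -> Pi b -> a <> b -> ~ cox_edge B a b ->
  B a b = 0.
Proof.
move=> Pa Pb ab nE.
have [n [n03 nid]] : exists n, (0 < n < 3)%N /\ iter n (s_ a \o s_ b) = id.
  by apply: contrapT => H; apply: nE.
have [a1 b1] := (simple1 Pa, simple1 Pb).
have [pa pb] := (simple_pos Pa, simple_pos Pb).
have E x : s_ a (s_ b (s_ a (s_ b x))) = x.
  case: n n03 nid => [|[|[|//]]] // _ nid;
    last by have := congr1 (fun f => f x) nid.
  have E y : s_ a (s_ b y) = y by have := congr1 (fun f => f y) nid.
  by rewrite !E.
have E2 : s_ b (s_ a b) = - s_ a b.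
  have := congr1 (s_ a) (E b); rewrite reflK // refl_self //.
  rewrite (W_N _ (W_root (pos_root pa))) (W_N _ (W_root (pos_root pb))).
  by move/(congr1 -%R); rewrite opprK.
have pab : pos (s_ a b) by apply: refl_pos => // ba; apply: ab.
have E3 := refl_opp (pos_root pb) E2.
have := root_colinear (pos_root pab) pb pab.2 E3.
move=> /(congr1 (fun x => B x a)); rewrite reflE // !BE a1 (BC B b a); lra.
Qed.

Lemma finpart_component J j : J `<=` Pi -> finpart B J j ->
  exists C, [/\ C `<=` J, C j, finite_set (WJ B C)
    & forall i k, J i -> ~ C i -> C k -> B k i = 0].
Proof.
move=> JPi [_ [[a Ja <-] finC] Cj]; exists (component B J a); split=> //.
  by move=> ? [].
move=> i k Ji nCi [Jk Ck]; apply: no_edge_orth; [exact: JPi|exact: JPi| |].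
  by move=> ki; apply: nCi; rewrite -ki.
move=> e; apply: nCi; split=> //; apply: (rt_trans _ _ _ _ _ Ck).
exact: rt_step.
Qed.

Lemma finite_RU U : finite_set U -> finite_set (RU U).
Proof.
move=> finU; pose h u := xget 0 [set b | RU U b /\ s_ b = u].
apply: (@sub_finite_set _ _ (h @` U)); last exact: finite_image.
move=> b Rb; exists (s_ b); first by case: Rb.
rewrite /h; case: xgetP => [c _ [[pc _] E]|/(_ b)]; last by case.
by apply: refl_inj => //; case: Rb.
Qed.

(** The sum of the positive roots of a finite parabolic subgroup pairs to 1 with
    each of its simple roots, since the reflection in such a root permutes the
    other summands. *)
Lemma finite_rho C : C `<=` Pi -> finite_set (WJ B C) ->
  exists2 s, uniq s /\ (forall b, b \in s <-> RU (WJ B C) b)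
    & forall i, C i -> B (\sum_(b <- s) b) i = 1.
Proof.
move=> CPi /finite_RU/finite_seqP[s0 Es].
have us : uniq (undup s0) by apply: undup_uniq.
have ms b : b \in undup s0 <-> RU (WJ B C) b by rewrite mem_undup Es.
exists (undup s0) => //; move: (undup s0) us ms => s us ms i Ci.
have pi := simple_pos (CPi _ Ci); have i1 := pos1 pi.
have si : i \in s by apply/ms; split=> //; exact: WJ_refl.
have Wi := W_root (pos_root pi).
have Ii : PiU B Pi (WJ B C) i by rewrite PiU_WJ.
have mr b : b \in rem i s -> s_ i b \in rem i s.
  rewrite !mem_rem_uniq // !inE => /andP[bi bs]; apply/andP.
  have Rb := (ms b).1 bs; case/PiUP: Ii => [[_ Ui] Hi]; split.
    apply/negP => /eqP E; apply: (posN Rb.1).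
    by rewrite -(reflK i1 b) E (refl_self i1) opprK.
  apply/ms; split; first by apply: Hi => //; apply/eqP.
  by apply: (@subgroup_refl (WJ B C)) => //;
    [exact: W_subgroup|case: pi|case: Rb].
have pr : perm_eq [seq s_ i b | b <- rem i s] (rem i s).
  apply: uniq_perm; rewrite ?rem_uniq // ?(map_inj_uniq (can_inj (reflK i1)))
    ?rem_uniq //.
  move=> b; apply/mapP/idP => [[c cr ->]|br]; first exact: mr.
  by exists (s_ i b); [exact: mr|rewrite reflK].
rewrite (perm_big _ (perm_to_rem si)) big_cons.
set t := \sum_(j <- rem i s) j.
have : s_ i t = t.
  have -> : t = \sum_(b <- [seq s_ i b | b <- rem i s]) b by rewrite (perm_big
    _ pr).
  rewrite [in LHS](perm_big _ pr) big_map /=.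
  exact: (big_morph (s_ i) (fun x y => W_D x y Wi) (W_0 Wi)).
move=> /(congr1 (fun x => B x i)); rewrite reflE // !BE i1; lra.
Qed.

(** When all components of [J] are finite, each [j] in [J] occurs with a positive
    coefficient in a vector of the cone of [J] that pairs non-negatively with [J]
    and positively with [j]. *)
Lemma positive_pairing J j : J `<=` Pi -> J = finpart B J -> J j ->
  exists e, [/\ cone J e, forall i, J i -> 0 <= B (j + e) i & 0 < B (j + e) j].
Proof.
move=> JPi JE Jj; have : finpart B J j by rewrite -JE.
move=> /(finpart_component JPi)[C [CJ Cj finC orth]].
have CPi : C `<=` Pi by move=> ? /CJ/JPi.
have [s [us ms] rho] := finite_rho CPi finC.
have sC b : b \in s -> cone C b by move=> /ms/(RU_WJ_cone CPi).
have sj : j \in s by apply/ms; split; [exact/simple_pos/CPi|exact: WJ_refl].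
exists (\sum_(b <- rem j s) b).
have Es : j + \sum_(b <- rem j s) b = \sum_(b <- s) b.
  by rewrite [in RHS](perm_big _ (perm_to_rem sj)) big_cons.
rewrite Es; split; last by rewrite rho.
  rewrite big_seq; elim/big_ind: _ => [|x y|b /mem_rem /sC]; first exact: cone0.
    exact: coneD.
  exact: coneS.
move=> i Ji; case: (pselect (C i)) => Ci; first by rewrite rho.
rewrite Bsuml big_seq big1 // => b /sC/cone_span Sb.
by rewrite BC; apply: perp_span Sb => k Ck; rewrite BC; apply: orth.
Qed.

(** A vector of the cone of [X], separated into its part on a list [s] and a
    vector of the cone of the remaining elements. *)
Lemma cone_coef X s e : uniq s -> cone X e ->
  exists t e', [/\ forall a, 0 <= t a :> R, cone (X `\` [set` s]) e'
    & e = \sum_(a <- s) t a *: a + e'].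
Proof.
move=> us; move: e; apply: cone_ind => /=.
- exists (fun=> 0), 0; split=> //; first exact: cone0.
  by rewrite addr0 big1 // => a _; rewrite scale0r.
- move=> _ _ [t [e [t0 Xe ->]]] [t' [e' [t'0 Xe' ->]]].
  exists (fun a => t a + t' a), (e + e'); split; first by move=> a;
    apply: addr_ge0.
    exact: coneD.
  rewrite addrACA -big_split /=; congr (_ + _).
  by apply: eq_bigr => a _; rewrite scalerDl.
- move=> c _ c0 [t [e [t0 Xe ->]]]; exists (fun a => c * t a), (c *: e); split.
  + by move=> a; apply: mulr_ge0.
  + exact: coneZ.
  rewrite scalerDr scaler_sumr; congr (_ + _).
  by apply: eq_bigr => a _; rewrite scalerA.
- move=> k Xk; case: (boolP (k \in s)) => ks.
    exists (fun a => (a == k)%:R), 0; split; [by move=> a;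
      apply: ler0n|exact: cone0|].
    rewrite addr0 (bigD1_seq k) //= eqxx scale1r big1 ?addr0 // => a /negbTE ->.
    exact: scale0r.
  exists (fun=> 0), k; split=> //.
    by apply: sub_cone; split=> //; apply/negP.
  by rewrite big1 ?add0r // => a _; rewrite scale0r.
Qed.

Lemma seq_max s (f : V -> R) : s <> [::] ->
  exists2 a, a \in s & forall b, b \in s -> f b <= f a.
Proof.
elim: s => [//|a s IH] _; case: (pselect (s = [::])) => [->|/IH[b bs Hb]].
  by exists a; rewrite ?inE // => b; rewrite inE => /eqP ->.
case: (lerP (f b) (f a)) => fab.
  exists a; first exact: mem_head.
  by move=> c; rewrite inE => /orP[/eqP -> //|/Hb fc]; apply: le_trans fab.
exists b; first by rewrite inE bs orbT.
by move=> c; rewrite inE => /orP[/eqP ->|/Hb //]; apply: ltW.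
Qed.

Lemma simple_le0 a b : Pi a -> Pi b -> a <> b -> B a b <= 0.
Proof.
move=> Pa Pb; apply: (@canonical_le0 W); first exact: W_subgroup.
  by rewrite PiU_WJ.
by rewrite PiU_WJ.
Qed.

Lemma span_coef X x : span X x ->
  exists s (c : V -> R), [/\ uniq s, forall a, a \in s ->
    X a & x = \sum_(a <- s) c a *: a].
Proof.
move=> [n [f [c [Xf ->]]]].
exists (undup [seq f i | i <- enum 'I_n]), (fun a =>
  \sum_(i < n | f i == a) c i).
split; first exact: undup_uniq.
  by move=> a; rewrite mem_undup => /mapP[i _ ->].
under [RHS]eq_bigr do rewrite scaler_suml.
rewrite (exchange_big_dep predT) //=; apply: eq_bigr => i _.
have fi : f i \in undup [seq f i | i <- enum 'I_n].
  by rewrite mem_undup map_f // mem_enum.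
rewrite big_mkcond (bigD1_seq (f i)) ?undup_uniq //= eqxx big1 ?addr0 // => a.
by rewrite eq_sym => /negbTE ->.
Qed.

Section FiniteType.
Variable J : set V.
Hypotheses (JPi : J `<=` Pi) (JE : J = finpart B J).

(** Over a set of finite type, a combination that pairs non-positively with all
    its terms has non-positive coefficients. Let [tau] be a combination with
    positive coefficients that pairs positively with all the terms; if the largest
    ratio [m] of a coefficient of the combination to that of [tau] were positive,
    [m tau] minus the combination would have no term at the root reaching the
    maximum, and would pair positively with it, although distinct simple roots
    pair non-positively. *)
Lemma neg_coef s (c : V -> R) : uniq s -> (forall a, a \in s -> J a) ->
  (forall a, a \in s -> B (\sum_(b <- s) c b *: b) a <= 0) ->
  forall a, a \in s -> c a <= 0.
Proof.
move=> us sJ Hc a0 a0s.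
have [e He] : exists e : V -> V, forall j, J j ->
    [/\ cone J (e j), forall i, J i -> 0 <= B (j + e j) i & 0 < B (j + e j) j].
  have /choice[e He] : forall j, exists e, J j ->
      [/\ cone J e, forall i, J i -> 0 <= B (j + e) i & 0 < B (j + e) j].
    move=> j; case: (pselect (J j)) => Jj; last by exists 0.
    by have [e He] := positive_pairing JPi JE Jj; exists e.
  by exists e.
have ce : cone J (\sum_(j <- s) e j).
  rewrite big_seq; elim/big_ind: _ => [|x y|j /sJ /He[]//]; first exact: cone0.
  exact: coneD.
have [t [e' [t0 ce' Ee]]] := cone_coef us ce.
pose tau := \sum_(j <- s) (j + e j).
have tauE : tau = \sum_(j <- s) (1 + t j) *: j + e'.
  rewrite /tau big_split /= Ee addrA -big_split /=; congr (_ + _).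
  by apply: eq_bigr => j _; rewrite scalerDl scale1r.
have tau0 i : i \in s -> 0 < B tau i.
  move=> si; have Ji := sJ _ si.
  rewrite /tau Bsuml (bigD1_seq i) //= ltr_pwDl //; first by case: (He _ Ji).
  rewrite big_seq_cond sumr_ge0 // => j /andP[/sJ/He[_ + _] _]; exact.
have t1 j : 0 < 1 + t j by have := t0 j; lra.
have [a1 a1s H1] : exists2 a, a \in s & forall b, b \in s ->
  c b / (1 + t b) <= c a / (1 + t a).
  by apply: (seq_max (fun a => c a / (1 + t a))); move=> s0; rewrite s0 in a0s.
suff m0 : c a1 / (1 + t a1) <= 0.
  have := le_trans (H1 _ a0s) m0; rewrite pmulr_lle0 ?invr_gt0 //.
set m := c a1 / (1 + t a1) in H1 *; rewrite leNgt; apply/negP => m0.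
have : B (m *: tau - \sum_(b <- s) c b *: b) a1 <= 0.
  rewrite tauE scalerDr addrAC scaler_sumr -sumrB BDl Bsuml.
  have le1 : \sum_(b <- s) B (m *: ((1 + t b) *: b) - c b *: b) a1 <= 0.
    rewrite big_seq; apply: sumr_le0 => b bs; rewrite scalerA -scalerBl BZl.
    case: (eqVneq b a1) => [->|/eqP ba].
      by rewrite /m mulfVK ?subrr ?mul0r // gt_eqF.
    rewrite mulr_ge0_le0 ?simple_le0 //; try by apply/JPi/sJ.
    by rewrite subr_ge0 -ler_pdivrMr // H1.
  have le2 : B (m *: e') a1 <= 0.
    rewrite BZl mulr_ge0_le0 // ?(ltW m0) // BC.
    apply: cone_pos_le ce' => b [Jb nb]; apply: simple_le0;
      [exact/JPi/sJ|exact: JPi|].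
    by move=> E; apply: nb; rewrite /= -E.
  lra.
rewrite BBl BZl; have := Hc _ a1s; have := mulr_gt0 m0 (tau0 _ a1s); lra.
Qed.

Lemma span_neg x : span J x -> (forall a, J a -> B x a <= 0) -> cone J (- x).
Proof.
move=> /span_coef[s [c [us sJ E]]] Hx.
have cs a : a \in s -> c a <= 0.
  by apply: neg_coef => // b bs; rewrite -E; apply/Hx/sJ.
rewrite E -sumrN big_seq; elim/big_ind: _ => [|y z|a sa].
- exact: cone0.
- exact: coneD.
- by rewrite -scaleNr; apply: coneZ; [rewrite oppr_ge0 cs|exact/sub_cone/sJ].
Qed.

(** A set of simple roots of finite type is linearly independent. *)
Lemma simple_free j : J j -> ~ span (J `\ j) j.
Proof.
move=> Jj /span_coef[s [c [us sJ E]]].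
have js : j \notin s by apply/negP => /sJ[_]; apply.
have := @neg_coef (j :: s) (fun a => if a == j then 1 else - c a).
rewrite /= us js => /(_ isT).
have E0 : \sum_(b <- j :: s) (if b == j then 1 else - c b) *: b = 0.
  rewrite big_cons eqxx scale1r {1}E -big_split /= big_seq big1 // => a sa.
  case: eqP => [E'|_]; first by rewrite -E' sa in js.
  by rewrite scaleNr subrr.
rewrite E0 => /(_ _ _ j (mem_head _ _)); rewrite eqxx ler10 => H.
suff : false by []. 
by apply: H => a; rewrite ?B0l // inE => /orP[/eqP -> //|/sJ[]].
Qed.

Lemma cone_compl_span y : cone (Pi `\` J) y -> span J y -> y = 0.
Proof.
move=> cy Jy; apply: pointed; first by move: cy; apply: coneS => ? [].
apply: (coneS JPi); apply: span_neg => // a Ja; rewrite BC.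
apply: cone_pos_le cy => b [Pb nJb].
by apply: simple_le0 => //; [exact: JPi|move=> ab; apply: nJb; rewrite -ab].
Qed.

(** The span of [J] meets the cone of [Pi] in a face. The linear independence of
    [Pi] is not needed. *)
Lemma cone_add_span x y : cone Pi x -> cone Pi y -> span J (x + y) -> cone J x.
Proof.
move=> /(cone_split J)[k [z [ck cz ->]]]
  /(cone_split J)[k' [z' [ck' cz' ->]]] Jxy.
have {}ck : cone J k by move: ck; apply: coneS => ? [].
have {}ck' : cone J k' by move: ck'; apply: coneS => ? [].
have Pz a : cone (Pi `\` J) a -> cone Pi a by apply: coneS => ? [].
suff -> : z = 0 by rewrite addr0.
apply: (@cone_sum0 z z') => //; [exact: Pz|exact: Pz|].
apply: cone_compl_span; first exact: coneD.
have -> : z + z' = k + z + (k' + z') - (k + k') by rewrite addrACA [RHS]addrC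
  addKr.
by apply: spanB => //; apply: spanD; apply: cone_span.
Qed.

Lemma cone_in_span x : cone Pi x -> span J x -> cone J x.
Proof. by move=> cx Jx; apply: (@cone_add_span x 0); rewrite ?addr0 //;
  apply: cone0. Qed.

End FiniteType.

(** * Orthogonal projections *)

Lemma proj_spec J v : standing B Pi J ->
  perp B J (proj B J v) /\ span J (v - proj B J v).
Proof.
case=> _ _ dec _; rewrite /proj; case: xgetP => [//|/=].
by have [x [y [Jx Jy ->]]] := dec v => /(_ y); case; rewrite addrK.
Qed.

Lemma proj_uniq J v y : standing B Pi J -> perp B J y -> span J (v - y) ->
  proj B J v = y.
Proof.
move=> stJ Jy Jvy; have [Jp Jvp] := proj_spec v stJ.
case: stJ => _ _ _ E0; have : [set 0] (proj B J v - y); last first.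
  by move/eqP; rewrite subr_eq0 => /eqP.
rewrite -E0; split; last exact: perpB.
have -> : proj B J v - y = (v - y) - (v - proj B J v).
  by rewrite opprB [RHS]addrC addrA subrK.
exact: spanB.
Qed.

Lemma proj_eq J a b : standing B Pi J -> span J (a - b) ->
  proj B J a = proj B J b.
Proof.
move=> stJ Jab; have [Jp Jbp] := proj_spec b stJ.
apply: proj_uniq => //;
  have -> : a - proj B J b = (a - b) + (b - proj B J b) by rewrite addrA subrK.
exact: spanD.
Qed.

Lemma projN J a : standing B Pi J -> proj B J (- a) = - proj B J a.
Proof.
move=> stJ; have [Jp Jap] := proj_spec a stJ; apply: proj_uniq => //.
  exact: perpN.
by rewrite -opprD; apply: spanN.
Qed.

Lemma proj_span_sub J a b : standing B Pi J -> proj B J a = proj B J b ->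
  span J (a - b).
Proof.
move=> stJ E; have [_ Ja] := proj_spec a stJ; have [_ Jb] := proj_spec b stJ.
have -> : a - b = (a - proj B J a) - (b - proj B J b).
  by rewrite E opprB addrA subrK.
exact: spanB.
Qed.

Lemma B_proj J v a : standing B Pi J -> perp B J v -> B v (proj B J a) = B v a.
Proof.
move=> stJ Jv; have [_ Jap] := proj_spec a stJ.
by have := perp_span Jv Jap; rewrite BBr => /eqP; rewrite subr_eq0 => /eqP.
Qed.

Lemma inv_image w J K : W w -> w @` J = K -> inv w @` K = J.
Proof.
move=> Ww <-; apply/seteqP; split=> [_ [_ [x Jx <-] <-]|x Jx];
  first by rewrite W_K.
by exists (w x); [exists x|rewrite W_K].
Qed.

Lemma span_W w J K x : W w -> w @` J = K -> span K (w x) <-> span J x.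
Proof.
move=> Ww wJ; split=> [/(W_span (W_inv Ww))|/(W_span Ww)]; last by rewrite wJ.
by rewrite W_K // (inv_image Ww wJ).
Qed.

Lemma perp_W w J K x : W w -> w @` J = K -> perp B J x -> perp B K (w x).
Proof. by move=> Ww <- Jx _ [j Jj <-]; rewrite W_B // Jx. Qed.

Lemma proj_W w J K a : W w -> w @` J = K -> standing B Pi J ->
  standing B Pi K ->
  proj B K (w a) = w (proj B J a).
Proof.
move=> Ww wJ stJ stK; have [Jp Jap] := proj_spec a stJ.
apply: proj_uniq => //; first exact: (perp_W Ww wJ).
by rewrite -(W_subr _ _ Ww); apply/(span_W _ Ww wJ).
Qed.

(** * Reflection subgroups with one canonical root outside J *)

Lemma RJ_group J U : RJ B Pi J U -> is_subgroup U /\ U `<=` W.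
Proof.
move=> [E _ _]; rewrite E; split; first exact: gen_subgroup.
apply: gen_min; first exact: W_subgroup.
by move=> t [_ [b rb <-]]; apply: W_root.
Qed.

Lemma RJ_base J U : J `<=` Pi -> RJ B Pi J U ->
  PiU B Pi U = J `|` [set rUJ B Pi U J] /\ ~ J (rUJ B Pi U J).
Proof.
move=> JPi [_ JU [r Er]]; rewrite /rUJ; case: xgetP => [//|/(_ r) /=]; case.
have JP : J `<=` PiU B Pi U.
  by move=> j Jj; apply: PiU_simple; [exact: JPi|apply: JU; exact: WJ_refl].
have [Pr nJr] : (PiU B Pi U `\` J) r by rewrite Er.
split=> //; apply/seteqP; split=> [a Pa|a [/JP //|-> //]].
case: (pselect (J a)) => Ja; first by left.
by right; have : (PiU B Pi U `\` J) a; [split|rewrite Er].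
Qed.

Lemma rUJ_eq J U r : PiU B Pi U = J `|` [set r] -> ~ J r -> rUJ B Pi U J = r.
Proof.
move=> E nJr; rewrite /rUJ; case: xgetP => [s _ [Es nJs]|/(_ r) /=];
  last by case.
have : (J `|` [set s]) r by rewrite -Es E; right.
by case=> // ->.
Qed.

Section Coefficients.
Variables (U : set (V -> V)) (J : set V) (r : V).
Hypotheses (sU : is_subgroup U) (UW : U `<=` W) (JPi : J `<=` Pi).
Hypotheses (UE : PiU B Pi U = J `|` [set r]) (nJr : ~ J r).

Lemma base_RU a : J a -> RU U a.
Proof. by move=> Ja; apply: PiU_RU; rewrite UE; left. Qed.

Lemma top_RU : RU U r.
Proof. by apply: PiU_RU; rewrite UE; right. Qed.

Lemma RU_coef b : RU U b -> exists c x, [/\ 0 <= c, cone J x & b = c *: r + x].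
Proof. by move=> /(canonical_cone sU UW); rewrite UE => /cone_add1. Qed.

(** Reflecting in [J] does not change the class of [b] modulo the span of [J], so
    one may assume that [b] pairs non-positively with [J]. Writing
    [b = c r + x] with [x] in the cone of [J], this gives
    [1 = B b b <= c * B b r] and [B b r <= c], whence [1 <= c]. *)
Lemma coef_ge1 b : RU U b -> ~ span J b ->
  exists2 c, 1 <= c & span J (b - c *: r).
Proof.
have [n] := ubnP (l (s_ b)); elim: n b => // n IH b ltn Rb nJb.
case: (pselect (exists2 j, J j & 0 < B b j)) => [[j Jj Bbj]|H].
  have Pj := JPi Jj; have [pb Ub] := Rb.
  have bj : b <> j by move=> E; apply: nJb; rewrite E; apply: sub_span.
  have Ej : s_ j b = b - (2 * B b j) *: j by rewrite reflE ?simple1.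
  have Jk k : span J (k *: j) by apply/spanZ/sub_span.
  have [|||c c1 Jc] := IH (s_ j b).
  - by apply: leq_trans (ell_refl_lt Pj pb bj Bbj) _; rewrite -ltnS.
  - split; first exact: refl_pos.
    by apply: subgroup_refl => //; [exact: root_simple|case: (base_RU Jj)].
  - move=> Js; apply: nJb;
      have -> : b = s_ j b + (2 * B b j) *: j by rewrite Ej subrK.
    exact: spanD.
  exists c => //; have -> : b - c *: r = s_ j b - c *: r + (2 * B b j) *: j.
    by rewrite Ej (addrAC b) subrK.
  exact: spanD.
have Hle j : J j -> B b j <= 0.
  by move=> Jj; rewrite leNgt; apply/negP => Bbj; apply: H; exists j.
have [c [x [c0 Jx E]]] := RU_coef Rb; exists c; last first.
  by rewrite E addrAC subrr add0r; apply: cone_span.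
have h1 : B b x <= 0 by apply: cone_pos_le Jx.
have h2 : B r x <= 0.
  apply: cone_pos_le Jx => j Jj; apply: (canonical_le0 sU).
  - by rewrite UE; right.
  - by rewrite UE; left.
  - by move=> rj; apply: nJr; rewrite rj.
have h3 : 1 = c * B b r + B b x.
  by rewrite -{1}(pos1 Rb.1) {2}E !BE (BC B b r).
have h4 : B b r = c + B r x by rewrite E !BE (pos1 top_RU.1) mulr1 (BC B x r).
nra.
Qed.

Hypothesis JE : J = finpart B J.

Lemma canonical_nspan a : PiU B Pi U a -> ~ J a -> ~ span J a.
Proof.
move=> Ua nJa Ja; apply: (canonical_extremal Ua).
have : cone J a by apply: (cone_in_span JPi JE) => //; case: (PiU_RU Ua) => -[].
by apply: coneS => j Jj; split; [exact: base_RU|move=> ja; apply: nJa;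
  rewrite -ja].
Qed.

(** The canonical roots of [U] are linearly independent. *)
Lemma canonical_free a : PiU B Pi U a -> ~ span (PiU B Pi U `\ a) a.
Proof.
have nr : ~ span J r by apply: canonical_nspan => //; rewrite UE; right.
rewrite UE => -[Ja|->] sp; last first.
  by apply: nr; move: sp; apply: spanS => x [[//|->] []]; exact.
have [c [x [Jx E]]] : exists c x, span (J `\ a) x /\ a = c *: r + x.
  have gen z : span ((J `|` [set r]) `\ a) z ->
      exists c x, span (J `\ a) x /\ z = c *: r + x.
    move: z; apply: span_ind => /=.
    - by exists 0, 0; split; [exact: span0|rewrite scale0r addr0].
    - move=> _ _ [c [x [Jx ->]]] [d [y [Jy ->]]]; exists (c + d), (x + y).
      by split; [exact: spanD|rewrite scalerDl addrACA].
    - move=> k _ [c [x [Jx ->]]]; exists (k * c), (k *: x).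
      by split; [exact: spanZ|rewrite scalerDr scalerA].
    - move=> z [[Jz|->] za].
        by exists 0, z; split; [exact: sub_span|rewrite scale0r add0r].
      by exists 1, 0; split; [exact: span0|rewrite scale1r addr0].
  exact: gen.
case: (eqVneq c 0) => [c0|c0].
  by apply: (simple_free JPi JE Ja); move: E; rewrite c0 scale0r add0r => {2}->.
apply: nr; have -> : r = c^-1 *: (a - x) by rewrite E addrK scalerA mulVf
  ?scale1r.
apply/spanZ/spanB; first exact: sub_span.
by move: Jx; apply: spanS => ? [].
Qed.

End Coefficients.

(** * Transport along a morphism *)

Lemma conj_reflection w U : W w -> reflection_subgroup B Pi U ->
  reflection_subgroup B Pi (conjU w U).
Proof.
move=> Ww E; have sU : is_subgroup U by rewrite E; apply: gen_subgroup.
apply/seteqP; split=> [_ [u Uu <-]|]; last first.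
  by apply: gen_min => [|t []//]; apply: conj_subgroup.
have Wi := W_inv Ww.
set G := gen (conjU w U `&` Trefl B Pi).
have sG : is_subgroup (conjU (inv w) G) by apply: conj_subgroup => //;
  apply: gen_subgroup.
have : U `<=` conjU (inv w) G.
  rewrite {1}E; apply: gen_min => // t [+ [b rb bt]]; rewrite -{t}bt => Ub.
  rewrite -[b](W_K Ww); apply/(conj_refl _ _ Wi).
  apply: sub_gen; split; first exact/conj_refl.
  by exists (w b) => //; apply: root_W.
move=> /(_ _ Uu)[g Gg <-]; rewrite invK //.
suff -> : w \o (inv w \o g \o w) \o inv w = g by [].
by apply/funext => x /=; rewrite !W_VK.
Qed.

Lemma conj_id u U : is_subgroup U -> U `<=` W -> U u -> conjU u U = U.
Proof.
move=> [U1 U2 U3] UW Uu; have Wu := UW _ Uu.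
have Ui : U (inv u) by apply: (U3 u) => //; [exact: W_K|exact: W_VK].
apply/seteqP; split=> [_ [v Uv <-]|v Uv].
  by apply: (U2) => //; apply: (U2).
exists (inv u \o v \o u); first by apply: (U2) => //; apply: (U2).
by apply/funext => x /=; rewrite !W_VK.
Qed.

Lemma conj_comp w u U : W w -> W u -> conjU (w \o u) U = conjU w (conjU u U).
Proof.
move=> Ww Wu; apply/seteqP; split=> [_ [v Uv <-]|_ [_ [v Uv <-] <-]].
  exists (u \o v \o inv u); first by exists v.
  by rewrite inv_comp.
by exists v => //; rewrite inv_comp.
Qed.

Section Transport.
Variables (J K : set V) (w : V -> V) (U : set (V -> V)).
Hypotheses (JPi : J `<=` Pi) (KPi : K `<=` Pi).
Hypotheses (stJ : standing B Pi J) (stK : standing B Pi K).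
Hypotheses (Ww : W w) (wJ : w @` J = K) (RU_J : RJ B Pi J U).

Local Notation r := (rUJ B Pi U J).
Local Notation U' := (conjU w U).

(** The sign [e] is that of the root [w r]. Modulo the span of [K], every root of
    the conjugate [U'] is a multiple of [w r]. The canonical roots of [U'] are
    linearly independent, being the images of those of [U] under a minimal coset
    representative; hence only one of them, [q], lies outside [K]. The
    coefficient of [e w r] on [q] and that of [e' w^-1 q] on [r], where [e'] is
    the sign of the root [w^-1 q], are both at least 1, and their product is
    [e e']; so both equal 1. *)
Lemma RJ_transport : RJ B Pi K U' /\ exists e : R,
  [/\ e = 1 \/ e = -1, pos (e *: w r) & span K (e *: w r - rUJ B Pi U' K)].
Proof.
have [_ JE _ _] := stJ; have [_ KE _ _] := stK.
have [sU UW] := RJ_group RU_J; have [UE nJr] := RJ_base JPi RU_J.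
have [_ JU _] := RU_J.
have [u Uu yP] := min_coset sU UW Ww.
have Wu := UW _ Uu; pose y := w \o u; have Wy : W y by apply: W_comp.
have U'E : conjU y U = U' by rewrite /y (conj_comp _ Ww Wu) (conj_id sU UW Uu).
have sU' : is_subgroup U' by apply: conj_subgroup.
have U'W : U' `<=` W by apply: conj_W.
have QE : PiU B Pi U' = y @` PiU B Pi U by rewrite -U'E conj_PiU.
have nr : ~ span J r by apply: (canonical_nspan JPi UE JE) => //; rewrite UE;
  right.
have nrho : ~ span K (w r) by move/(span_W _ Ww wJ).
have WK : WJ B K `<=` U'.
  apply: gen_min => // _ [k + <-]; rewrite -wJ => -[j Jj <-].
  by apply/conj_refl => //; apply: JU; apply: WJ_refl.
have KQ : K `<=` PiU B Pi U'.
  by move=> k Kk; apply: PiU_simple; [exact: KPi|apply: WK; apply: WJ_refl].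
have back b : RU U' b -> exists e : R, (e = 1 \/ e = -1) /\ RU U (e *: inv w b).
  move=> [pb Ub]; have rb : root (inv w b) by apply: root_W;
    [exact: W_inv|case: pb].
  have Ub' : U (s_ (inv w b)) by apply/(conj_refl _ _ Ww); rewrite W_VK.
  case: (RU_or rb Ub') => Rb; first by exists 1; rewrite scale1r; split;
    [left|].
  by exists (-1); rewrite scaleN1r; split; [right|].
have coef b : RU U' b -> exists c, span K (b - c *: w r).
  move=> /back[e [e1 /(RU_coef sU UW UE)[c [x [c0 Jx E]]]]].
  have ee : e * e = 1 by case: e1 => ->; ring.
  exists (e * c); have -> : b - (e * c) *: w r = e *: w x.
    apply: (@can_inj _ _ (inv w) w (W_VK Ww)).
    have Wi := W_inv Ww; rewrite (W_subr _ _ Wi) !(W_Z _ _ Wi) !(W_K Ww).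
    have -> : inv w b = e *: (c *: r + x) by rewrite -E scalerA ee scale1r.
    by rewrite scalerDr scalerA addrAC subrr add0r.
  by apply/spanZ/(span_W _ Ww wJ)/cone_span.
have nK a : PiU B Pi U' a -> ~ K a -> ~ span K a.
  move=> Qa nKa Ka; apply: (canonical_extremal Qa).
  have : cone K a by apply: (cone_in_span KPi KE) => //;
    case: (PiU_RU Qa) => -[].
  apply: coneS => k Kk; split; first by apply/PiU_RU/KQ.
  by move=> ka; apply: nKa; rewrite -ka.
have [e0 [e01 Re0]] : exists e : R, (e = 1 \/ e = -1) /\ RU U' (e *: w r).
  have Rr : RU U r by apply: PiU_RU; rewrite UE; right.
  have rr : root (w r) by apply: root_W => //; case: Rr => -[].
  have Ur : U' (s_ (w r)) by apply/conj_refl => //; case: Rr.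
  case: (RU_or rr Ur) => Rb; first by exists 1; rewrite scale1r; split; [left|].
  by exists (-1); rewrite scaleN1r; split; [right|].
have ee0 : e0 * e0 = 1 by case: e01 => ->; ring.
have [q Qq nKq] : exists2 q, PiU B Pi U' q & ~ K q.
  apply: contrapT => H; apply: nrho.
  have : cone (PiU B Pi U') (e0 *: w r) by apply: canonical_cone.
  move=> /(@coneS _ _ _ K) h; rewrite -[w r]scale1r -ee0 -scalerA;
    apply/spanZ/cone_span/h.
  by move=> a Qa; apply: contrapT => nKa; apply: H; exists a.
(* Two canonical roots outside [K] would be dependent modulo the span of [K]. *)
have uniq q' : PiU B Pi U' q' -> ~ K q' -> q' = q.
  move=> Qq' nKq'; apply: contrapT => qq'.
  have [c Hc] := coef _ (PiU_RU Qq); have [c' Hc'] := coef _ (PiU_RU Qq').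
  have c0 : c != 0.
    by apply/eqP => c0; apply: (nK _ Qq nKq); move: Hc;
      rewrite c0 scale0r subr0.
  have sp : span (PiU B Pi U' `\ q') q'.
    have Eq : (q' - c' *: w r) - (c' / c) *: (q - c *: w r) + (c' / c) *: q =
      q'.
      by rewrite scalerBr scalerA mulfVK // opprB addrA subrK subrK.
    rewrite -[X in span _ X]Eq.
    apply: spanD; last by apply: spanZ; apply: sub_span; split=> // E;
      apply: qq'.
    have KS : K `<=` PiU B Pi U' `\ q'.
      by move=> k Kk; split; [exact: KQ|move=> E; apply: nKq'; rewrite -E].
    by apply: spanB; [exact: spanS Hc'|apply/spanZ; exact: spanS Hc].
  have [p Pp Ep] : (y @` PiU B Pi U) q' by rewrite -QE.
  apply: (canonical_free JPi UE nJr JE Pp).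
  have := W_span (W_inv Wy) sp; rewrite -Ep W_K //;
    apply: spanS => _ [a [Qa na] <-].
  have [p' Pp' Ep'] : (y @` PiU B Pi U) a by rewrite -QE.
  by rewrite -Ep' W_K //; split=> // E; apply: na; rewrite -Ep' E.
have Q_E : PiU B Pi U' = K `|` [set q].
  apply/seteqP; split=> [a Qa|a [/KQ //|-> //]].
  by case: (pselect (K a)) => Ka; [left|right; apply: uniq].
split.
  split=> //; first by apply: conj_reflection; case: RU_J.
  exists q; rewrite Q_E; apply/seteqP; split=> [a [[//|-> //]]|_ ->].
  by split=> //; right.
rewrite (rUJ_eq Q_E nKq); exists e0; split=> //; first by case: Re0.
have ne0 : ~ span K (e0 *: w r).
  by move=> /(spanZ e0); rewrite scalerA ee0 scale1r.
have [a a1 Ha] := coef_ge1 sU' U'W KPi Q_E nKq Re0 ne0.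
have [e [e1 Re]] := back _ (PiU_RU Qq).
have ee : e * e = 1 by case: e1 => ->; ring.
have nq : ~ span J (e *: inv w q).
  move=> /(spanZ e); rewrite scalerA ee scale1r => /(span_W _ Ww wJ).
  by rewrite W_VK //; apply: nK.
have [c c1 Hc] := coef_ge1 sU UW JPi UE nJr Re nq.
have {}Hc : span K (e *: q - c *: w r).
  by move/(span_W _ Ww wJ): Hc; rewrite (W_subr _ _ Ww) !(W_Z _ _ Ww) (W_VK Ww).
have key : e * e0 - a * c = 0.
  apply/eqP/negP => /negP ne; apply: nrho.
  have -> : w r = (e * e0 - a * c)^-1 *: (e *: (e0 *: w r - a *: q) + a *: (e
    *: q - c *: w r)).
    rewrite !scalerBr !scalerA (mulrC e a) addrA subrK -scalerBl scalerA.
    by rewrite mulVf ?scale1r.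
  by apply/spanZ/spanD; apply: spanZ.
have ac1 : 1 <= a * c by nra.
have a_1 : a = 1 by case: e1 e01 key => -> [] ->; nra.
by move: Ha; rewrite a_1 scale1r.
Qed.

End Transport.

(** * Inversion sets *)

(** An inversion of [w] is a positive root made negative by the inverse of [w].
    The reflections in the inversions of an element of a standard parabolic
    subgroup belong to that subgroup. *)
Lemma neg_WJ I w b : I `<=` Pi -> WJ B I w -> pos b -> pos (- inv w b) ->
  WJ B I (s_ b).
Proof.
move=> IPi /(WJ_word IPi)[s sI ->] pb.
have sP a : a \in s -> Pi a by move=> /sI/IPi.
rewrite (inv_can (wd_revK sP) (wd_revK' sP)) =>
  /(exchange sP pb)[s1 [a [s2 [E -> _]]]].
have s1I (c : V) : c \in s1 -> I c by move=> cs; apply: sI;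
  rewrite E mem_cat cs.
have Ia : I a by apply: sI; rewrite E mem_cat mem_head orbT.
have Is1 := WJ_wd s1I; have Ws1 := WJS IPi Is1.
rewrite -(W_conj _ Ws1); apply: WJ_comp; last exact: (sub_inv (W_subgroup I)).
by apply: WJ_comp => //; apply: WJ_refl.
Qed.

Lemma finite_neg w : W w -> finite_set [set b | pos b /\ pos (- inv w b)].
Proof.
move=> /W_word[s sP ->].
apply: (@sub_finite_set _ _
  [set` [seq wd (take i s) (nth 0 s i) | i <- iota 0 (size s)]]);
    last exact: finite_seq.
move=> b [pb]; rewrite (inv_can (wd_revK sP) (wd_revK' sP)).
move=> /(exchange sP pb)[s1 [a [s2 [E -> _]]]] /=; apply/mapP.
exists (size s1); first by rewrite mem_iota E size_cat /= add0n addnS ltnS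
  leq_addr.
by rewrite E take_size_cat // nth_cat ltnn subnn.
Qed.

(** * Realized roots *)

Lemma XJ_RJ (X : kind) J U : XJ B Pi X J U -> RJ B Pi J U.
Proof. by case: X => //= -[]. Qed.

Lemma parabolic_conj w U : W w -> parabolic B Pi U ->
  parabolic B Pi (conjU w U).
Proof.
move=> Ww [v [v' [I [Wv [vv' v'v] IPi ->]]]].
exists (w \o v), (v' \o inv w), I; split=> //; first exact: W_comp.
  by split=> x /=; rewrite ?W_K ?vv' ?v'v ?W_VK.
apply/seteqP; split=> [_ [_ [u Iu <-] <-]|_ [u Iu <-]]; first by exists u.
by exists (v \o u \o v') => //; exists u.
Qed.

Lemma XJ_conj (X : kind) J K w U : J `<=` Pi -> K `<=` Pi ->
  standing B Pi J -> standing B Pi K ->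
  W w -> w @` J = K -> XJ B Pi X J U -> XJ B Pi X K (conjU w U).
Proof.
move=> JPi KPi stJ stK Ww wJ XU.
have [RK _] := RJ_transport JPi KPi stJ stK Ww wJ (XJ_RJ XU).
case: X XU => //= -[RU_ HU]; split=> //; last exact: parabolic_conj.
move=> U' RU' UU'; have [RU'i _]
  := RJ_transport KPi JPi stK stJ (W_inv Ww) (inv_image Ww wJ) RU'.
rewrite -(conjVK U' Ww) (HU _ RU'i) // -(conjK U Ww).
exact: conj_sub.
Qed.

Lemma ups_move (X : kind) J K w U : J `<=` Pi -> K `<=` Pi ->
  standing B Pi J -> standing B Pi K ->
  W w -> w @` J = K -> XJ B Pi X J U -> let r := rUJ B Pi U J in
  (pos (w r) /\ Ups_pos B Pi X K (w (proj B J r))) \/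
  (pos (- w r) /\ Ups_neg B Pi X K (w (proj B J r))).
Proof.
move=> JPi KPi stJ stK Ww wJ XU r.
have XU' := XJ_conj JPi KPi stJ stK Ww wJ XU.
have [_ [e [e1 pe sp]]] := RJ_transport JPi KPi stJ stK Ww wJ (XJ_RJ XU).
have E := proj_eq stK sp.
case: e1 pe E => ->; rewrite ?scale1r ?scaleN1r => pe E; [left|right];
  split=> //.
  by rewrite -(proj_W _ Ww wJ) // E; exists (conjU w U).
exists (- w (proj B J r)); last by rewrite opprK.
by rewrite -(proj_W _ Ww wJ) // -projN // E; exists (conjU w U).
Qed.

Lemma ups_disjoint (X : kind) J a : J `<=` Pi -> standing B Pi J ->
  Ups_pos B Pi X J a -> ~ Ups_neg B Pi X J a.
Proof.
move=> JPi stJ [U1 /XJ_RJ R1 <-] [_ [U2 /XJ_RJ R2 <-] /esym].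
rewrite -projN // => /(proj_span_sub stJ); rewrite opprK.
have [E1 n1] := RJ_base JPi R1; have [E2 n2] := RJ_base JPi R2.
have Q1 : PiU B Pi U1 (rUJ B Pi U1 J) by rewrite E1; right.
have Q2 : PiU B Pi U2 (rUJ B Pi U2 J) by rewrite E2; right.
have [_ JE _ _] := stJ.
have [[c1 c2] _] : ((cone Pi (rUJ B Pi U1 J)) * cone Pi (rUJ B Pi U2 J)) * True.
  by split=> //; split; apply: RU_cone; [exact: (PiU_RU Q1)|exact: (PiU_RU Q2)].
move=> /(cone_add_span JPi JE c1 c2)/cone_span.
exact: (canonical_nspan JPi E1 JE).
Qed.

(** If all canonical roots of [U] are simple, the reflections of [U] belong to
    the standard parabolic subgroup generated by these roots. *)
Lemma RU_simple_base U b : is_subgroup U -> U `<=` W -> PiU B Pi U `<=` Pi ->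
  RU U b -> WJ B (PiU B Pi U) (s_ b).
Proof.
move=> sU UW UPi; have [n] := ubnP (l (s_ b)); elim: n b => // n IH b ltn Rb.
have [pb Ub] := Rb.
have [a Ua Bba] : exists2 a, PiU B Pi U a & 0 < B b a.
  apply: contrapT => H; have : B b b <= 0.
    apply: (@cone_pos_le _ _ _ (PiU B Pi U)); last exact: canonical_cone.
    by move=> a Ua; rewrite leNgt; apply/negP => ?; apply: H; exists a.
  by rewrite pos1 // ler10.
have Wa : WJ B (PiU B Pi U) (s_ a) by apply: WJ_refl.
case: (pselect (b = a)) => [-> //|ba].
have Pa := UPi _ Ua; have ra := root_simple Pa.
have Wab : WJ B (PiU B Pi U) (s_ (s_ a b)).
  apply: IH; first by apply: leq_trans (ell_refl_lt Pa pb ba Bba) _;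
    rewrite -ltnS.
  split; first exact: refl_pos.
  by apply: subgroup_refl => //; case: (PiU_RU Ua).
rewrite -(reflK (simple1 Pa) b);
  apply: (@subgroup_refl (WJ B (PiU B Pi U))) => //.
exact: W_subgroup.
Qed.

(** A simple root outside [J] gives a member of [R_J], [M_J] and [P_J]. It is
    maximal because every larger member of [R_J] has the same canonical roots. *)
Lemma simple_XJ (X : kind) J a : J `<=` Pi -> Pi a -> ~ J a ->
  XJ B Pi X J (WJ B (J `|` [set a])) /\ rUJ B Pi (WJ B (J `|` [set a])) J = a.
Proof.
move=> JPi Pa nJa; set I := J `|` [set a].
have IPi : I `<=` Pi by move=> b [/JPi //|->].
have E : PiU B Pi (WJ B I) = I by apply: PiU_WJ.
split; last exact: rUJ_eq.
have R_ : RJ B Pi J (WJ B I).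
  split.
  - apply/seteqP; split; last by apply: gen_min => [|t []//]; exact: W_subgroup.
    apply: gen_min; first exact: gen_subgroup.
    move=> _ [b Ib <-]; apply: sub_gen; split; first exact: WJ_refl.
    by exists b => //; apply/root_simple/IPi.
  - by apply: WJS => b; left.
  - exists a; rewrite E; apply/seteqP; split=> [b [[//|-> //]]|_ ->].
    by split=> //; right.
case: X => //=; split=> //.
  move=> U' RU' sub; have [E' nJ'] := RJ_base JPi RU'.
  have : PiU B Pi U' a by apply: PiU_simple => //; apply: sub; apply: WJ_refl;
    right.
  rewrite E' => -[//|aE]; apply/seteqP; split=> //.
  have [sU' UW'] := RJ_group RU'.
  have [-> _ _] := RU'; apply: gen_min; first exact: W_subgroup.
  move=> t [Ut [b rb bt]]; rewrite -{t}bt in Ut *.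
  have PU : PiU B Pi U' `<=` Pi by rewrite E' => c [/JPi //|->]; rewrite -aE.
  have WPU b' : RU U' b' -> WJ B I (s_ b').
    by move=> Rb'; have := RU_simple_base sU' UW' PU Rb'; rewrite E' -aE.
  by case: (RU_or rb Ut) => /WPU; rewrite ?reflN.
exists id, id, I; split=> //; first exact: WJ_id.
by apply/seteqP; split=> [u Iu|_ [u Iu <-] //]; exists u.
Qed.

(** * The Tits cone *)

Section Groupoid.
Variable ob : set (set V).
Hypothesis hG : brink_howlett B Pi ob.
Hypothesis hob : forall J, ob J -> standing B Pi J.

Lemma ob_sub J : ob J -> J `<=` Pi.
Proof. by case: hG => F [_ ->] [J0 _ [w []]]. Qed.

Lemma ob_image J w : ob J -> W w -> w @` J `<=` Pi -> ob (w @` J).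
Proof.
case: hG => F [_ ->] [J0 FJ0 [v [J0Pi JPi Wv vJ0]]] Ww wJPi.
exists J0 => //; exists (w \o v); split=> //; first exact: W_comp.
by rewrite -vJ0 -image_comp.
Qed.

Lemma hom_image J w : ob J -> W w -> w @` J `<=` Pi -> hom B Pi ob (w @` J) w J.
Proof. by move=> obJ Ww wJ; split=> //; [exact: ob_image|split=> //;
  exact: ob_sub].
Qed.

Lemma hom_id J : ob J -> hom B Pi ob J id J.
Proof.
by move=> obJ; split=> //; split;
  [exact: ob_sub|exact: ob_sub|exact: WJ_id|exact: image_id].
Qed.

Lemma hom_inv K w J : hom B Pi ob K w J -> hom B Pi ob J (inv w) K.
Proof.
move=> [obJ obK [JPi KPi Ww wJ]]; split=> //; split=> //; first exact: W_inv.
exact: inv_image.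
Qed.

Lemma hom_comp L (v : V -> V) K w J : hom B Pi ob L v K ->
  hom B Pi ob K w J -> hom B Pi ob L (v \o w) J.
Proof.
move=> [_ obL [_ LPi Wv vK]] [obJ obK [JPi KPi Ww wJ]].
by split=> //; split=> //; [exact: W_comp|rewrite -vK -wJ -image_comp].
Qed.

Lemma chamber_cone J v x : chamber B Pi J v -> ob J -> cone Pi x -> 0 <= B v x.
Proof.
move=> [Jv Cv] obJ; apply: cone_pos_ge => a Pa.
case: (pselect (J a)) => Ja; first by rewrite Jv.
by rewrite -(B_proj a (hob obJ) Jv); apply: Cv; exists a.
Qed.

Lemma tits_move J w K x : hom B Pi ob J w K -> tits B Pi ob K x ->
  tits B Pi ob J (w x).
Proof.
move=> hw [L obL [v hv [y Cy <-]]]; exists L => //; exists (w \o v);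
  last by exists y.
exact: (hom_comp hw hv).
Qed.

(** The points of the orthogonal of [J] that pair negatively with only finitely
    many real positive elements and with no imaginary one. *)
Definition halfspaces (X : kind) J : set V :=
  [set v | [/\ perp B J v,
    finite_set [set a | Ups_re_pos B Pi ob X J a /\ B v a < 0]
    & forall a, Ups_im_pos B Pi ob X J a -> 0 <= B v a]].

Lemma tits_sub (X : kind) J : ob J -> tits B Pi ob J `<=` halfspaces X J.
Proof.
move=> obJ v [K obK [w hw [u Cu <-]]].
have [_ _ [KPi JPi Ww wK]] := hw.
have stJ := hob obJ; have stK := hob obK.
have Jv : perp B J (w u) by apply: (perp_W Ww wK); case: Cu.
have Wi := W_inv Ww; have wJ := inv_image Ww wK.
have neg a : root a -> B (w u) (proj B J a) < 0 -> pos (- inv w a).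
  move=> ra; rewrite B_proj // => lt0; apply: npos; first exact: root_W.
  move=> [_ ca]; have := chamber_cone Cu obK ca.
  by rewrite -(W_B _ _ Ww) W_VK // leNgt lt0.
have rootr U : XJ B Pi X J U -> pos (rUJ B Pi U J).
  move=> /XJ_RJ RU_; have [E _] := RJ_base JPi RU_.
  by case: (@PiU_RU U (rUJ B Pi U J)) => //; rewrite E; right.
split=> //.
  apply: (@sub_finite_set _ _ (proj B J @` [set b | pos b /\ pos (- inv w b)])).
    move=> _ [[[U XU <-] _] lt0]; exists (rUJ B Pi U J) => //.
    by have pr := rootr _ XU; split=> //; apply: neg => //; case: pr.
  exact/finite_image/finite_neg.
move=> a [[U XU <-] nre]; rewrite leNgt; apply/negP => lt0; apply: nre.
split; first by exists U.
have pr := rootr _ XU.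
exists K, (inv w); split; first exact: hom_inv.
case: (ups_move JPi KPi stJ stK Wi wJ XU) => -[] // pi.
by case: (posN pi); apply: neg => //; case: pr.
Qed.

(** A morphism from [J] that makes the simple root [a] negative yields an element
    [b] of the parabolic subgroup of [J + a] carrying [J] into [J + a] and making
    [a] negative. It is the inverse of the element [u] of that subgroup for which
    [w u] has minimal length. *)
Lemma simple_exchange J K w a : hom B Pi ob K w J -> Pi a -> ~ J a ->
  pos (- w a) ->
  exists b : V -> V, [/\ WJ B (J `|` [set a]) b,
    b @` J `<=` J `|` [set a] & pos (- b a)].
Proof.
move=> [obJ obK [JPi KPi Ww wJ]] Pa nJa wa.
set I := J `|` [set a].
have IPi : I `<=` Pi by move=> b [/JPi //|->].
have sI := W_subgroup I; have IW := WJS IPi.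
have [u Iu yP] := min_coset sI IW Ww.
have Wu := IW _ Iu; have Wy := W_comp Ww Wu; have Wui := W_inv Wu.
have Ii : WJ B I (inv u) by exact: (sub_inv sI).
exists (inv u); split=> //.
  move=> _ [j Jj <-].
  have : PiU B Pi (conjU (w \o u) (WJ B I)) (w j).
    apply: PiU_simple; first by apply: KPi; rewrite -wJ; exists j.
    rewrite (conj_comp _ Ww Wu) (conj_id sI IW Iu).
    by apply/conj_refl => //; apply: WJ_refl; rewrite /I; left.
  rewrite conj_PiU // PiU_WJ // => -[i Ii' E].
  suff <- : i = inv u j by [].
  by apply: (can_inj (W_K Wy)); rewrite E /= W_VK.
apply: npos; first exact/root_W/root_simple.
move=> pa; have : RU (WJ B I) (inv u a).
  split=> //; rewrite -(W_conj _ Wui) invK //; case: sI => _ I2 _.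
  by apply: (I2) => //; apply: (I2) => //; apply: WJ_refl; rewrite /I; right.
by move=> /yP; rewrite W_VK // => /posN; apply.
Qed.

(** Induction on the size of a list [s] containing the real positive elements that
    pair negatively with [v]. If [a] is a simple root with [B v a < 0], the list
    for [b v] consists of the images under [b] of the elements of [s] other than
    [pi_J a]. *)
Lemma sub_tits (X : kind) J : ob J -> halfspaces X J `<=` tits B Pi ob J.
Proof.
move=> obJ v [Jv /finite_seqP[s Es] Him].
have {Es} : forall a, Ups_re_pos B Pi ob X J a -> B v a < 0 -> a \in s.
  by move=> a ra lt0; have : [set` s] a by rewrite -Es.
have [n] := ubnP (size s);
  elim: n s J obJ v Jv Him => // n IH s J obJ v Jv Him ltn Hs.
have JPi := ob_sub obJ; have stJ := hob obJ; have [_ JE _ _] := stJ.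
case: (pselect (exists2 a, (Pi `\` J) a & B v a < 0)) => [[a [Pa nJa] lt0]|H];
  last first.
  exists J => //; exists id; first exact: hom_id.
  exists v => //; split=> // _ [a PJa <-]; rewrite B_proj // leNgt.
  by apply/negP => lt0; apply: H; exists a.
set I := J `|` [set a]; set U := WJ B I; set pa := proj B J a.
have [XU rE] := simple_XJ X JPi Pa nJa; rewrite -/I -/U in XU rE.
have IPi : I `<=` Pi by move=> b [/JPi //|->].
have UE : PiU B Pi U = I by apply: PiU_WJ.
have Upa : Ups_pos B Pi X J pa by exists U; rewrite ?rE.
have pa0 : B v pa < 0 by rewrite B_proj.
have re_pa : Ups_re_pos B Pi ob X J pa.
  by apply: contrapT => nre; have := Him pa (conj Upa nre); rewrite leNgt pa0.
have [K [w [hw neg_w]]] : exists K w,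
  hom B Pi ob K w J /\ Ups_neg B Pi X K (w pa).
  by case: re_pa.
have [_ obK [_ KPi Ww wJ]] := hw; have stK := hob obK; have [_ KE _ _] := stK.
have wa : pos (- w a).
  apply: npos; first exact/root_W/root_simple.
  move=> [_ cwa]; case: neg_w => _ [U' XU' <-] E.
  have [E' _] := RJ_base KPi (XJ_RJ XU').
  have cr : cone Pi (rUJ B Pi U' K) by apply: (@RU_cone U'); apply: PiU_RU;
    rewrite E'; right.
  have : span K (w a - - rUJ B Pi U' K).
    by apply: proj_span_sub => //; rewrite projN // E (proj_W _ Ww wJ).
  rewrite opprK => /(cone_add_span KPi KE cwa cr)/cone_span/(span_W _ Ww wJ) Ja.
  case: hroot => _ /(_ a Pa) + _ _; apply.
  have := cone_in_span JPi JE (sub_cone Pa) Ja; apply: coneS => j Jj; split;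
    first exact: JPi.
  by move=> ja; apply: nJa; rewrite -ja.
have [b [Ub bJI ba]] := simple_exchange hw Pa nJa wa.
have Wb : W b := WJS IPi Ub; have Wbi := W_inv Wb.
have LPi : b @` J `<=` Pi by move=> x /bJI/IPi.
have hb := hom_image obJ Wb LPi.
have [L bJ] : exists L, b @` J = L by exists (b @` J).
rewrite bJ in bJI LPi hb; have [_ obL _] := hb.
have stL := hob obL; have hbi := hom_inv hb.
have bL := inv_image Wb bJ.
have sU : is_subgroup U by apply: W_subgroup.
have UW : U `<=` W by apply: WJS.
have [RL [e [e1 pe sp]]] := RJ_transport JPi LPi stJ stL Wb bJ (XJ_RJ XU).
have XLU := XJ_conj JPi LPi stJ stL Wb bJ XU.
rewrite (conj_id sU UW Ub) rE in RL sp XLU pe.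
set r1 := rUJ B Pi U L in sp.
have {e1 pe}em : e = -1.
  by case: e1 pe => // ->; rewrite scale1r => pba; case: (posN pba ba).
rewrite {}em scaleN1r in sp.
have [UL nL] := RJ_base LPi RL; rewrite -/r1 in UL nL.
have Lv : perp B L (b v) by apply: (perp_W Wb bJ).
have Br1 : 0 < B (b v) r1.
  have := perp_span Lv sp; rewrite BBr BNr W_B // => /eqP;
    rewrite subr_eq0 => /eqP <-.
  by rewrite oppr_gt0.
(* A negative value of [b v] comes from a negative value of [v]: the root [q]
   cannot be an inversion of [b], as it would be [k r1 + x] with [0 <= k] and
   [x] in the cone of [L], hence pair non-negatively with [b v]. *)
have back (c : V) : Ups_pos B Pi X L c -> B (b v) c < 0 ->
    Ups_pos B Pi X J (inv b c) /\ B v (inv b c) < 0.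
  move=> [U1 XU1 <-]; set q := rUJ B Pi U1 L => ltc.
  split; last by rewrite -(W_B _ _ Wb) W_VK.
  case: (ups_move LPi JPi stL stJ Wbi bL XU1) => -[] //; rewrite -/q => pN.
  have [Eq nq] := RJ_base LPi (XJ_RJ XU1).
  have pq : pos q by case: (@PiU_RU U1 q) => //; rewrite Eq; right.
  have Rq : RU U q by split=> //; apply: (neg_WJ IPi Ub pq pN).
  have [k [x [k0 Lx E]]] := RU_coef sU UW UL Rq.
  move: ltc; rewrite B_proj // E BDr BZr (perp_span Lv (cone_span Lx)) addr0.
  by rewrite ltNge mulr_ge0 // ltW.
have pas : pa \in s by apply: Hs.
have tb : tits B Pi ob L (b v).
  apply: (IH [seq b x | x <- s & x != pa]) => //.
  - move=> c [Uc nre]; rewrite leNgt; apply/negP => ltc.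
    have [Uic ltic] := back c Uc ltc.
    have : 0 <= B v (inv b c).
      apply: Him; split=> // -[_ [K2 [w2 [hw2 nw2]]]]; apply: nre; split=> //.
      by exists K2, (w2 \o inv b); split=> //; exact: (hom_comp hw2 hbi).
    by rewrite leNgt ltic.
  - rewrite size_map size_filter; rewrite ltnS in ltn; apply: leq_trans ltn.
    rewrite -(count_predC (pred1 pa) s) /= -[X in (X < _)%N]add0n ltn_add2r.
    by rewrite -has_count has_pred1.
  - move=> c [Uc [K2 [w2 [hw2 nw2]]]] ltc.
    have [Uic ltic] := back c Uc ltc.
    rewrite -[c](W_VK Wb); apply: map_f; rewrite mem_filter; apply/andP; split.
      (* The image of [pa] under [b] is negative. *)
      apply/eqP => E; apply: (ups_disjoint LPi stL Uc).
      rewrite -[c](W_VK Wb) E /pa -(proj_W _ Wb bJ) //.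
      exists (proj B L r1); first by exists U.
      by rewrite -(proj_eq stL sp) projN // opprK.
    apply: Hs => //; split=> //; exists K2, (w2 \o b); rewrite /= W_VK //;
      split=> //.
    exact: (hom_comp hw2 hb).
by rewrite -[v](W_K Wb); apply: (tits_move hbi tb).
Qed.

Lemma titsE (X : kind) J : ob J -> tits B Pi ob J = halfspaces X J.
Proof. by move=> obJ; apply/seteqP; split;
  [exact: tits_sub|exact: sub_tits]. Qed.

Lemma tits_image J w K : hom B Pi ob J w K ->
  w @` tits B Pi ob K = tits B Pi ob J.
Proof.
move=> hw; have [_ _ [_ _ Ww _]] := hw.
apply/seteqP; split=> [_ [x Xx <-]|y Xy]; first exact: tits_move hw _.
by exists (inv w y); [apply: tits_move Xy; exact: hom_inv|rewrite W_VK].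
Qed.

Lemma chamber_convex J : convex_cone (chamber B Pi J).
Proof.
apply: convex_coneP.
- by split=> [|a _]; [exact: perp0|rewrite B0l].
- move=> x y [Jx Cx] [Jy Cy]; split=> [|a Da]; first exact: perpD.
  by rewrite BDl addr_ge0 ?Cx ?Cy.
- move=> c x c0 [Jx Cx]; split=> [|a Da]; first exact: perpZ.
  by rewrite BZl mulr_ge0 ?Cx.
Qed.

Lemma halfspaces_convex (X : kind) J : convex_cone (halfspaces X J).
Proof.
apply: convex_coneP.
- split=> [||a _]; [exact: perp0| |by rewrite B0l].
  apply: (@sub_finite_set _ _ set0) => // a [_]; by rewrite B0l ltxx.
- move=> x y [Jx fx ix] [Jy fy iy]; split=> [||a ia]; first exact: perpD.
    have fxy : finite_set ([set a | Ups_re_pos B Pi ob X J a /\ B x a < 0] `|`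
        [set a | Ups_re_pos B Pi ob X J a /\ B y a < 0]) by rewrite finite_setU.
    apply: sub_finite_set fxy => a [ra].
    rewrite BDl => lt0; case: (ltP (B x a) 0) => xa; [by left|right].
    by split=> //; lra.
  by rewrite BDl addr_ge0 ?ix ?iy.
- move=> c x c0 [Jx fx ix]; split=> [||a ia]; first exact: perpZ.
    apply: sub_finite_set fx => a [ra]; rewrite BZl => lt0; split=> //.
    by rewrite ltNge; apply/negP => xa; move: lt0; rewrite ltNge mulr_ge0.
  by rewrite BZl mulr_ge0 ?ix.
Qed.

End Groupoid.
End RootSystem.

Theorem theorem1p65 (R : realType) (V : lmodType R) (B : {symmetric V})
  (Pi : set V) (ob : set (set V))
  (hroot : based_root_system B Pi)
  (hG : brink_howlett B Pi ob)
  (hob : forall J : set V, ob J -> standing B Pi J)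
  (J : set V) (hJ : ob J) :
  [/\ (* (a) *)
      tits B Pi ob J =
      [set v | [/\ perp B J v,
                   finite_set [set a | Ups_re_pos B Pi ob kR J a /\ B v a < 0]
                 & forall a, Ups_im_pos B Pi ob kR J a -> 0 <= B v a]],
      (* (b) *)
      forall X : kind,
      tits B Pi ob J =
      [set v | [/\ perp B J v,
                   finite_set [set a | Ups_re_pos B Pi ob X J a /\ B v a < 0]
                 & forall a, Ups_im_pos B Pi ob X J a -> 0 <= B v a]],
      (* (c) *)
      forall (w : V -> V) (K : set V),
      hom B Pi ob J w K -> w @` tits B Pi ob K = tits B Pi ob J
    & (* (d) *)
      [/\ chamber B Pi J `<=` tits B Pi ob J,
          tits B Pi ob J `<=` perp B J,
          convex_cone (chamber B Pi J)
        & convex_cone (tits B Pi ob J)]].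
Proof.
have E := fun X : kind => titsE hroot hG hob X hJ.
split; [exact: (E kR)|exact: E|by move=> w K; exact: tits_image|].
split.
- move=> v Cv; exists J => //; exists id; last by exists v.
  exact: hom_id.
- by rewrite (E kR) => v [].
- exact: chamber_convex.
- by rewrite (E kR); exact: halfspaces_convex.
Qed.
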